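(* Let $P_-$ be the set of $(q,v)\in TS^3$ with $q_0\neq\pm1$ and $E(q,v)<0$. A smooth map $\Phi:P_-\to T^+S^3$, $(q,v)\mapsto(x,y)$, intertwines the momentum map $\mathcal J$ and the map $J$, that is $\Phi^*\mathcal J=\mathcal J\circ\Phi=J$, if and only if $$\Phi(q,v)=(x,y)=\big(\alpha\sin\varphi+\beta\cos\varphi,\ \nu(-\alpha\cos\varphi+\beta\sin\varphi)\big),$$ where $$\alpha=(\alpha_0,\boldsymbol\alpha)=\Big(\frac{1}{\nu q_0}\,\boldsymbol q\cdot\boldsymbol\pi,\ \frac{\boldsymbol q}{|\boldsymbol q|}-\frac{\boldsymbol q\cdot\boldsymbol\pi}{\gamma q_0}\boldsymbol\pi\Big),\qquad \beta=(\beta_0,\boldsymbol\beta)=\Big(\frac{|\boldsymbol q|}{\gamma q_0}\boldsymbol\pi\cdot\boldsymbol\pi-1,\ \frac{|\boldsymbol q|}{\nu q_0}\boldsymbol\pi\Big),$$ $\nu=\frac{\gamma}{\sqrt{-2E}}$, and $\varphi$ is an arbitrary smooth real function on $P_-$.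
   Context: Notation: $\langle\cdot,\cdot\rangle$ is the Euclidean inner product on $\mathbb{R}^4$; $\cdot$, $\times$, $|\cdot|$ are the dot product, cross product and norm on $\mathbb{R}^3$. Write $q=(q_0,\boldsymbol q)$, $v=(v_0,\boldsymbol v)\in\mathbb{R}\times\mathbb{R}^3$, and $TS^3=\{(q,v): \langle q,q\rangle=1,\ \langle q,v\rangle=0\}$. Fix $\gamma>0$. On the part of $TS^3$ with $q_0\ne\pm1$ set $H(q,v)=\frac12\langle v,v\rangle-\gamma\frac{q_0}{(1-q_0^2)^{1/2}}$, $\boldsymbol\mu=\boldsymbol q\times\boldsymbol v$, $\boldsymbol\pi=q_0\boldsymbol v-v_0\boldsymbol q$, $\boldsymbol A=\boldsymbol\pi\times\boldsymbol\mu-\gamma\frac{\boldsymbol q}{|\boldsymbol q|}$, $\boldsymbol e=\boldsymbol A/\gamma$, and $E=H-\frac12|\boldsymbol\mu|^2=\frac12|\boldsymbol\pi|^2-\gamma\frac{q_0}{|\boldsymbol q|}$. If $E<0$ then $q_0>0$. Where $E<0$, set $\nu=\gamma/\sqrt{-2E}$, $\widetilde{\boldsymbol e}=-\nu\boldsymbol e$, and $J(q,v)=(\boldsymbol\mu,\widetilde{\boldsymbol e})\in\mathbb{R}^3\times\mathbb{R}^3$. Further, $T^+S^3=\{(x,y)\in\mathbb{R}^4\times\mathbb{R}^4:\langle x,x\rangle=1,\ \langle x,y\rangle=0,\ y\ne0\}$. Writing $x=(x_0,\boldsymbol x)$, $y=(y_0,\boldsymbol y)$, the momentum map of the standard $SO(4)$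 action is $\mathcal J(x,y)=x\wedge y$, identified with the pair $(\boldsymbol x\times\boldsymbol y,\ x_0\boldsymbol y-y_0\boldsymbol x)\in\mathbb{R}^3\times\mathbb{R}^3\cong\mathfrak{so}(4)$. *)

(* Defs.v *)
From mathcomp Require Import all_boot all_order all_algebra.
From mathcomp Require Import all_classical all_reals all_analysis.

Set Implicit Arguments.
Unset Strict Implicit.
Unset Printing Implicit Defensive.

Import Order.TTheory GRing.Theory Num.Theory.
Import numFieldNormedType.Exports.

Local Open Scope classical_set_scope.
Local Open Scope ring_scope.

Section smoothness.
Context {R : realType} {V W : normedModType R}.
Implicit Types (U A : set V) (f : V -> W).

(* Meant for U open and V finite-dimensional: quantifying over all directions v
   then amounts to continuity of the full Frechet derivative. *)
Fixpoint Ck (k : nat) U f : Prop :=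
  match k with
  | 0 => forall x, U x -> {for x, continuous f}
  | k'.+1 => (forall x, U x -> differentiable f x) /\
             (forall v, Ck k' U (fun x => 'D_v f x))
  end.

Definition Cinfty U f : Prop := forall k, Ck k U f.

(* Smoothness on an arbitrary subset A, by local smooth extension to the ambient
   space; for an embedded submanifold A this is the intrinsic notion.  Values of
   f outside A are irrelevant. *)
Definition smooth_on A f : Prop :=
  forall x, A x -> exists (U : set V) (g : V -> W),
    [/\ open U, U x, Cinfty U g & forall y, U y -> A y -> g y = f y].

Definition smooth_map A (B : set W) f : Prop := smooth_on A f /\ set_fun A B f.

End smoothness.

Section euclidean.
Context {R : realType}.

Definition dot {n} (u w : 'rV[R]_n) : R := \sum_(i < n) u 0 i * w 0 i.

(* Euclidean norm; the library's `|u| on matrices is the maximum norm. *)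
Definition enorm {n} (u : 'rV[R]_n) : R := Num.sqrt (dot u u).

Definition cross (u w : 'rV[R]_3) : 'rV[R]_3 :=
  \row_(k < 3) [:: u 0 1 * w 0 2 - u 0 2 * w 0 1;
                   u 0 2 * w 0 0 - u 0 0 * w 0 2;
                   u 0 0 * w 0 1 - u 0 1 * w 0 0]`_k.

Definition sca (q : 'rV[R]_4) : R := (lsubmx (q : 'rV[R]_(1 + 3))) 0 0.

Definition vec (q : 'rV[R]_4) : 'rV[R]_3 := rsubmx (q : 'rV[R]_(1 + 3)).

Definition quat (a : R) (u : 'rV[R]_3) : 'rV[R]_4 := row_mx a%:M u.

End euclidean.

Section kepler.
Context {R : realType}.
Implicit Types p z : 'rV[R]_4 * 'rV[R]_4.

Definition TS3 : set ('rV[R]_4 * 'rV[R]_4) :=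
  [set p | dot p.1 p.1 = 1 /\ dot p.1 p.2 = 0].

Definition TplusS3 : set ('rV[R]_4 * 'rV[R]_4) :=
  [set z | [/\ dot z.1 z.1 = 1, dot z.1 z.2 = 0 & z.2 != 0]].

(* The momentum map of SO(4): x /\ y under so(4) = R^3 x R^3. *)
Definition momentum z : 'rV[R]_3 * 'rV[R]_3 :=
  (cross (vec z.1) (vec z.2), sca z.1 *: vec z.2 - sca z.2 *: vec z.1).

Definition mu p : 'rV[R]_3 := cross (vec p.1) (vec p.2).

Definition pi_ p : 'rV[R]_3 := sca p.1 *: vec p.2 - sca p.2 *: vec p.1.

Variable gamma : R.

Definition H p : R :=
  2^-1 * dot p.2 p.2 - gamma * (sca p.1 / Num.sqrt (1 - sca p.1 ^+ 2)).

Definition E p : R := H p - 2^-1 * enorm (mu p) ^+ 2.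

Definition A p : 'rV[R]_3 :=
  cross (pi_ p) (mu p) - gamma *: ((enorm (vec p.1))^-1 *: vec p.1).

Definition e p : 'rV[R]_3 := gamma^-1 *: A p.

Definition nu p : R := gamma / Num.sqrt (- 2 * E p).

Definition etilde p : 'rV[R]_3 := - nu p *: e p.

Definition J p : 'rV[R]_3 * 'rV[R]_3 := (mu p, etilde p).

Definition Pminus : set ('rV[R]_4 * 'rV[R]_4) :=
  [set p | [/\ TS3 p, sca p.1 != 1, sca p.1 != -1 & E p < 0]].

Definition alpha p : 'rV[R]_4 :=
  quat ((nu p * sca p.1)^-1 * dot (vec p.1) (pi_ p))
       ((enorm (vec p.1))^-1 *: vec p.1
        - (dot (vec p.1) (pi_ p) / (gamma * sca p.1)) *: pi_ p).

Definition beta p : 'rV[R]_4 :=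
  quat (enorm (vec p.1) / (gamma * sca p.1) * dot (pi_ p) (pi_ p) - 1)
       ((enorm (vec p.1) / (nu p * sca p.1)) *: pi_ p).

End kepler.

(* Main.v *)
Require Import Defs.
From HB Require Import structures.
From mathcomp Require Import all_boot all_order all_algebra.
From mathcomp Require Import all_classical all_reals all_analysis.
From mathcomp Require Import ring lra.

(** The vectors [alpha p] and [beta p] are orthonormal and [J p] is [nu p] times
    the bivector [alpha p /\ beta p] ([alpha_beta_orthonormal],
    [momentum_alpha_beta]).  Hence the wedge product of the two components of a
    rotated frame is [nu (sin^2 + cos^2) (alpha /\ beta) = J], and as [nu],
    [alpha] and [beta] are smooth on [Pminus], every smooth [phi] gives a map
    with the required properties.

    Conversely, a bivector [x /\ y] with [x] a unit vector orthogonal to [y]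
    determines an oriented plane and the length of [y], but the unit vector [x]
    may be turned freely in the plane.  Contracting [x /\ y = nu (alpha /\ beta)]
    with [x] and with [y] shows that [(x, y)] is the frame turned by an angle
    with cosine [<beta, x>] and sine [<alpha, x>] ([wedge_rotation]).  For
    [x = (Phi p).1] these are smooth functions of [p], and what remains is to
    choose the angle itself smoothly on all of [Pminus].

    This is possible because [Pminus] is simply connected.  Negative energy
    forces [q0 > 0], and [chart] identifies [Pminus] with the product of
    punctured three-space and three-space.  There a continuous angle exists
    ([punctured_lift]): on the complement of a half-axis, which is star-shaped,
    it is transported along segments from the centre ([star_lift]), and on the
    overlap of the complements of two opposite half-axes, which is connected,
    the two angles so obtained differ by a constant.  Locally a continuous angle
    is a constant plus the arctangent of a smooth function ([smooth_lift]), so it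
    is smooth.

    Smoothness in the sense of [Ck] is handled by a small calculus: closure under
    sums, products, continuous linear maps and composition with scalar functions
    whose derivatives are known. *)

Set Implicit Arguments.
Unset Strict Implicit.
Unset Printing Implicit Defensive.

Import Order.TTheory GRing.Theory Num.Theory.
Import numFieldNormedType.Exports.
Local Open Scope classical_set_scope.
Local Open Scope ring_scope.

(** * Functions of class Ck *)

Section Ck_calculus.
Context {R : realType}.
Implicit Types V W : normedModType R.

(** [Ck] compares derivatives with explicit formulas only on an open set, so
    differentiability has to be transported along equality near a point. *)
Lemma differentiable_near_eq V W (f g : V -> W) (x : V) :
  (\forall y \near x, f y = g y) -> differentiable f x -> differentiable g x.
Proof.
move=> fg df.
have fgx : f x = g x by apply: nbhs_singleton fg.
(* [g] has the expansion of [f], with the differential of [f]; uniqueness of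
   the differential then identifies the two. *)
have gE : g \o shift x = cst (g x) + 'd f x +o_ 0 id.
  apply/eqaddoP => eps eps0.
  have /eqaddoP /(_ _ eps0) := diff_locally df.
  have : \forall h \near (0 : V), f (h + x) = g (h + x).
    by move: fg; rewrite (near_shift 0) subr0.
  apply: filter_app2; near=> h => fgh; by rewrite !fctE /= -fgx -fgh.
have dE : 'd g x = 'd f x :> (V -> W) by apply: diff_unique => //; exact: diff_continuous.
by apply/diff_locallyP; rewrite dE; split => //; exact: diff_continuous.
Unshelve. all: by end_near. Qed.

Lemma Ck_ext V W k (U : set V) (f g : V -> W) : open U ->
  (forall x, U x -> f x = g x) -> Ck k U f -> Ck k U g.
Proof.
elim: k f g => [|k IH] f g oU fg /=.
  move=> cf x Ux; rewrite /prop_for /continuous_at -(fg _ Ux).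
  apply: cvg_trans (cf x Ux); apply: near_eq_cvg.
  by near=> y; apply: fg; near: y; exact: open_nbhs_nbhs.
move=> [df cf]; have nfg x : U x -> \forall y \near x, f y = g y.
  by move=> Ux; near=> y; apply: fg; near: y; exact: open_nbhs_nbhs.
split=> [x Ux|v]; first exact: differentiable_near_eq (nfg _ Ux) (df _ Ux).
apply: IH (cf v) => // x Ux; apply: near_eq_derive; exact: nfg.
Unshelve. all: by end_near. Qed.

(** Differentiability implies continuity, at the last stage of the recursion. *)
Lemma CkS V W k (U : set V) (f : V -> W) : Ck k.+1 U f -> Ck k U f.
Proof.
elim: k f => [|k IH] f /=; first by move=> [df _] x /df /differentiable_continuous.
by move=> [df cf]; split=> // v; apply: IH.
Qed.

Lemma Ck_subset V W k (U U' : set V) (f : V -> W) : U' `<=` U ->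
  Ck k U f -> Ck k U' f.
Proof.
move=> sU; elim: k f => [|k IH] f /=; first by move=> cf x /sU; exact: cf.
by move=> [df cf]; split=> [x /sU|v]; [exact: df|exact: IH].
Qed.

Lemma Ck_cst V W k (U : set V) (a : W) : Ck k U (cst a).
Proof.
elim: k a => [|k IH] a /=; first by move=> x _; exact: cst_continuous.
split=> [x _|v]; first exact: differentiable_cst.
have -> : (fun x : V => 'D_v (cst a) x) = cst 0.
  by apply/funext => x; exact: derive_cst.
exact: IH.
Qed.

Lemma CkD V W k (U : set V) (f g : V -> W) : open U ->
  Ck k U f -> Ck k U g -> Ck k U (f + g).
Proof.
move=> oU; elim: k f g => [|k IH] f g /=.
  by move=> cf cg x Ux; apply: continuousD; [exact: cf|exact: cg].
move=> [df cf] [dg cg]; split=> [x Ux|v].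
  by apply: differentiableD; [exact: df|exact: dg].
apply: Ck_ext (IH _ _ (cf v) (cg v)) => // x Ux.
by rewrite deriveD//; apply: diff_derivable; [exact: df|exact: dg].
Qed.

Lemma Ck_lin V W W' k (U : set V) (L : {linear W -> W'}) (f : V -> W) :
  open U -> continuous L -> Ck k U f -> Ck k U (L \o f).
Proof.
move=> oU cL; elim: k f => [|k IH] f /=.
  by move=> cf x Ux; apply: continuous_comp; [exact: cf|exact: cL].
have dL y : differentiable L y by exact: linear_differentiable.
move=> [df cf]; split=> [x Ux|v].
  by apply: differentiable_comp => //; exact: df.
apply: Ck_ext (IH _ (cf v)) => // x Ux /=.
have dfx := df x Ux.
rewrite !deriveE//; last exact: differentiable_comp.
by rewrite (diff_comp dfx (dL _))/= diff_lin.
Qed.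

Lemma CkM V k (U : set V) (f g : V -> R^o) : open U ->
  Ck k U f -> Ck k U g -> Ck k U (fun x => f x * g x : R^o).
Proof.
move=> oU; elim: k f g => [|k IH] f g.
  by move=> cf cg x Ux; apply: continuousM; [exact: cf|exact: cg].
move=> cf1 cg1; have [cf' cg'] := (CkS cf1, CkS cg1).
move: cf1 cg1 => /= [df cf] [dg cg]; split=> [x Ux|v].
  by apply: differentiableM; [exact: df|exact: dg].
apply: Ck_ext (CkD oU (IH _ _ cf' (cg v)) (IH _ _ cg' (cf v))) => // x Ux.
rewrite -[RHS]/('D_v (f * g) x) deriveM//.
all: by apply: diff_derivable; [exact: df || exact: dg].
Qed.

(** Each directional derivative of a composite is a product of a derivative of
    the outer function, composed again, with one of the inner function; this is
    what makes the induction on the order of differentiability close. *)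
Lemma Ck_comp V k (U : set V) (I : set R^o) (h : R^o -> R^o) (f : V -> R^o) :
  open U -> (forall x, U x -> I (f x)) ->
  Ck k I h -> Ck k U f -> Ck k U (h \o f).
Proof.
move=> oU fI; elim: k h f fI => [|k IH] h f fI.
  by move=> ch cf x Ux; apply: continuous_comp; [exact: cf|exact/ch/fI].
move=> ch1 cf1; have cf' := CkS cf1.
move: ch1 cf1 => /= [dh ch] [df cf]; split=> [x Ux|v].
  by apply: differentiable_comp; [exact: df|exact/dh/fI].
apply: Ck_ext (CkM oU (IH _ _ fI (ch (1 : R)) cf') (cf v)) => // x Ux /=.
have [dfx dhx] := (df x Ux, dh _ (fI _ Ux)).
rewrite !deriveE//; last exact: differentiable_comp.
rewrite (diff_comp dfx dhx)/=.
have -> : 'd f x v = 'd f x v *: (1 : R^o) by rewrite /GRing.scale/= mulr1.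
by rewrite linearZ /= /GRing.scale/= mulr1 mulrC.
Qed.

End Ck_calculus.

Section Cinfty_elementary.
Context {R : realType}.

(** Smoothness of a scalar function from a formula for its derivative: it is
    enough that the formula inherit each finite order from the function. *)
Lemma Cinfty_derive1 (I : set R^o) (h h' : R^o -> R^o) : open I ->
  (forall x, I x -> is_derive x (1 : R) h (h' x)) ->
  (forall k, Ck k I h -> Ck k I h') -> Cinfty I h.
Proof.
move=> oI dh ch; elim=> [|k IH] /=.
  move=> x Ix; apply: differentiable_continuous.
  by apply/derivable1_diffP; case: (dh x Ix).
have difh x : I x -> differentiable h x.
  by move=> Ix; apply/derivable1_diffP; case: (dh x Ix).
split=> // v.
apply: Ck_ext (CkM oI (@Ck_cst _ R^o R^o k I v) (ch _ IH)) => // x Ix.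
rewrite deriveE; last exact: difh.
have -> : v = v *: (1 : R^o) by rewrite /GRing.scale/= mulr1.
rewrite linearZ/= -deriveE; last exact: difh.
by case: (dh x Ix) => _ ->; rewrite /GRing.scale/= mulr1.
Qed.

Lemma Ck_opp (V : normedModType R) k (U : set V) (f : V -> R^o) : open U ->
  Ck k U f -> Ck k U (fun x => - f x : R^o).
Proof.
move=> oU cf.
apply: Ck_ext (CkM oU (@Ck_cst R V R^o k U (-1)) cf) => // x _.
by rewrite mulN1r.
Qed.

Lemma openR_neq0 : open [set x : R^o | x != 0].
Proof. exact: open_neq. Qed.

Lemma Cinfty_inv : Cinfty [set x : R^o | x != 0] (fun x : R^o => x^-1 : R^o).
Proof.
apply: (@Cinfty_derive1 _ _ (fun x => - (x^-1 * x^-1))) => [|x x0|k ck].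
- exact: openR_neq0.
- apply: is_derive_eq; first by apply: is_deriveV; exact: x0.
  by rewrite /GRing.scale/= mulr1 -exprVn expr2.
- by apply: Ck_opp; [exact: openR_neq0|apply: CkM; [exact: openR_neq0| |]].
Qed.

Lemma Cinfty_sqrt : Cinfty [set x : R^o | 0 < x] (@Num.sqrt R : R^o -> R^o).
Proof.
have o0 : open [set x : R^o | 0 < x] by exact: open_gt.
apply: (@Cinfty_derive1 _ _ (fun x => (2 * Num.sqrt x)^-1) o0 _ _) => k ck.
apply: (@Ck_comp _ _ _ _ [set x : R^o | x != 0] (fun x => x^-1)) => //.
- by move=> x x0; rewrite /= mulf_neq0// gt_eqF// sqrtr_gt0.
- exact: Cinfty_inv.
- by apply: CkM => //; exact: Ck_cst.
Qed.

Lemma Cinfty_sin_cos :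
  Cinfty setT (@sin R : R^o -> R^o) /\ Cinfty setT (@cos R : R^o -> R^o).
Proof.
suff sc k : Ck k setT (@sin R : R^o -> R^o) /\ Ck k setT (@cos R : R^o -> R^o).
  by split=> k; have [] := sc k.
have dE (h h' : R^o -> R^o) (v : R^o) : (forall x, is_derive x (1 : R) h (h' x)) ->
    (fun x => 'D_v h x) = (fun x => v * h' x).
  move=> dh; apply/funext => x.
  have dhx : differentiable h x by apply/derivable1_diffP; case: (dh x).
  rewrite deriveE//; have -> : v = v *: (1 : R^o) by rewrite /GRing.scale/= mulr1.
  rewrite linearZ/= -deriveE//.
  by case: (dh x) => _ ->; rewrite /GRing.scale/= mulr1.
elim: k => [|k [IHs IHc]] /=.
  by split=> x _; [exact: continuous_sin|exact: continuous_cos].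
split; split=> [x _|v].
- by apply/derivable1_diffP; exact: derivable_sin.
- rewrite (dE _ (@cos R)).
  by apply: CkM => //; [exact: openT|exact: Ck_cst].
- by apply/derivable1_diffP; exact: derivable_cos.
- rewrite (dE _ (fun x => - sin x)).
  by apply: CkM => //; [exact: openT|exact: Ck_cst|apply: Ck_opp => //; exact: openT].
Qed.

Lemma Cinfty_id : Cinfty setT (id : R^o -> R^o).
Proof.
apply: (@Cinfty_derive1 _ _ (cst 1) openT) => k _.
exact: Ck_cst.
Qed.

Lemma Cinfty_atan : Cinfty setT (@atan R : R^o -> R^o).
Proof.
apply: (@Cinfty_derive1 _ _ (fun x => (1 + x ^+ 2)^-1) openT) => k _.
apply: (@Ck_comp _ _ _ _ [set x : R^o | x != 0] (fun x => x^-1)).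
- exact: openT.
- by move=> x _; rewrite /= gt_eqF// ltr_pwDl// sqr_ge0.
- exact: Cinfty_inv.
- apply: CkD; [exact: openT|exact: Ck_cst|].
  by apply: CkM; [exact: openT|exact: Cinfty_id|exact: Cinfty_id].
Qed.

End Cinfty_elementary.

(** * Smoothness at a point relative to a subset *)

Section smooth_at.
Context {R : realType}.
Implicit Types V W : normedModType R.

(** Smoothness relative to [A] at a single point, so that the closure properties
    below need their side conditions (a denominator that does not vanish, a
    positive radicand) at that point only. *)
Definition smooth_at V W (A : set V) (f : V -> W) (x : V) : Prop :=
  exists (U : set V) (g : V -> W),
    [/\ open U, U x, Cinfty U g & forall y, U y -> A y -> g y = f y].

Lemma smooth_at_ext V W (A : set V) (f g : V -> W) x :
  (\forall y \near x, A y -> f y = g y) -> smooth_at A f x -> smooth_at A g x.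
Proof.
rewrite /prop_near1 nbhsE => -[U' [oU' U'x] fg] [U [h [oU Ux sh hf]]].
exists (U `&` U'), h; split=> //; first exact: openI.
  by move=> k; apply: Ck_subset (sh k) => y [].
by move=> y [Uy U'y] Ay; rewrite hf// fg.
Qed.

Lemma smooth_at_eq V W (A : set V) (f g : V -> W) x :
  (forall y, A y -> f y = g y) -> smooth_at A f x -> smooth_at A g x.
Proof. by move=> fg; apply: smooth_at_ext; exact: nearW. Qed.

Lemma smooth_at_cst V W (A : set V) (a : W) x : smooth_at A (cst a) x.
Proof. by exists setT, (cst a); split => //; [exact: openT|move=> k; exact: Ck_cst]. Qed.

Lemma smooth_at_lin V W W' (A : set V) (L : W -> W') (f : V -> W) x :
  linear L -> continuous L -> smooth_at A f x -> smooth_at A (fun y => L (f y)) x.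
Proof.
move=> lL cL [U [g [oU Ux sg gf]]].
pose L1 := GRing.isLinear.Build R W W' *:%R L lL.
pose L' : {linear W -> W'} := HB.pack L L1.
exists U, (L \o g); split=> //; last by move=> y Uy Ay /=; rewrite gf.
by move=> k; exact: (@Ck_lin _ _ _ _ _ _ L').
Qed.

Lemma smooth_atD V W (A : set V) (f g : V -> W) x :
  smooth_at A f x -> smooth_at A g x -> smooth_at A (fun y => f y + g y) x.
Proof.
move=> [U [f' [oU Ux sf ff]]] [U' [g' [oU' Ux' sg gg]]].
exists (U `&` U'), (f' + g'); split=> //; first exact: openI.
  move=> k; apply: CkD; first exact: openI.
    by apply: Ck_subset (sf k) => y [].
  by apply: Ck_subset (sg k) => y [].
by move=> y [Uy U'y] Ay; rewrite -[LHS]/(f' y + g' y) ff// gg.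
Qed.

Lemma smooth_at_sum V W (A : set V) n (f : 'I_n -> V -> W) x :
  (forall i, smooth_at A (f i) x) -> smooth_at A (fun y => \sum_(i < n) f i y) x.
Proof.
elim: n f => [|n IH] f sf.
  apply: smooth_at_eq (smooth_at_cst _ 0 x).
  by move=> y _; rewrite big_ord0.
apply: (@smooth_at_eq _ _ _ (fun y => f ord0 y + \sum_(i < n) f (lift ord0 i) y)).
  by move=> y _; rewrite big_ord_recl.
by apply: smooth_atD => //; exact: IH.
Qed.

Lemma smooth_atM V (A : set V) (f g : V -> R^o) x :
  smooth_at A f x -> smooth_at A g x -> smooth_at A (fun y => f y * g y : R^o) x.
Proof.
move=> [U [f' [oU Ux sf ff]]] [U' [g' [oU' Ux' sg gg]]].
exists (U `&` U'), (fun y => f' y * g' y); split=> //; first exact: openI.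
  move=> k; apply: CkM; first exact: openI.
    by apply: Ck_subset (sf k) => y [].
  by apply: Ck_subset (sg k) => y [].
by move=> y [Uy U'y] Ay; rewrite ff// gg.
Qed.

Lemma smooth_atN V (A : set V) (f : V -> R^o) x :
  smooth_at A f x -> smooth_at A (fun y => - f y : R^o) x.
Proof.
move=> sf; apply: (@smooth_at_eq _ _ _ (fun y => -1 * f y)).
  by move=> y _; rewrite mulN1r.
by apply: smooth_atM => //; exact: smooth_at_cst.
Qed.

Lemma smooth_atB V (A : set V) (f g : V -> R^o) x :
  smooth_at A f x -> smooth_at A g x -> smooth_at A (fun y => f y - g y : R^o) x.
Proof. by move=> sf sg; apply: smooth_atD => //; exact: smooth_atN. Qed.

Lemma smooth_at_continuous V W (A : set V) (f : V -> W) x : A x ->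
  smooth_at A f x -> f @ within A (nbhs x) --> f x.
Proof.
move=> Ax [U [g [oU Ux sg gf]]].
have cg : {for x, continuous g} := sg 0%N x Ux.
move=> B /=; rewrite -(gf x Ux Ax) => nB.
change (nbhs x (fun y => A y -> B (f y))).
have nU : nbhs x U by exact: open_nbhs_nbhs.
near=> y; move=> Ay; rewrite /= -(gf y _ Ay); last by near: y.
by near: y; exact: cg.
Unshelve. all: by end_near. Qed.

Lemma smooth_at_setT_continuous V W (f : V -> W) x :
  smooth_at setT f x -> {for x, continuous f}.
Proof.
move=> [U [g [oU Ux sg gf]]]; have cg : {for x, continuous g} := sg 0%N x Ux.
have fg : \forall y \near x, g y = f y.
  by near=> y; apply: gf => //; near: y; exact: open_nbhs_nbhs.
rewrite /prop_for /continuous_at -(nbhs_singleton fg).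
by apply: cvg_trans cg; exact: near_eq_cvg.
Unshelve. all: by end_near. Qed.

(** The condition that [h] is smooth only on an open [I] is met by shrinking the
    neighbourhood on which the extension of [f] is taken. *)
Lemma smooth_at_comp V (A : set V) (I : set R^o) (h : R^o -> R^o) (f : V -> R^o) x :
  open I -> Cinfty I h -> A x -> I (f x) ->
  smooth_at A f x -> smooth_at A (fun y => h (f y)) x.
Proof.
move=> oI sh Ax Ifx [U [g [oU Ux sg gf]]].
have cg y : U y -> {for y, continuous g} := sg 0%N y.
have oU' : open (U `&` g @^-1` I).
  rewrite openE => y [Uy Iy]; apply: filterI; first exact: open_nbhs_nbhs.
  by apply: cg => //; exact: open_nbhs_nbhs.
exists (U `&` g @^-1` I), (h \o g); split => //.
- by split=> //; rewrite /= gf.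
- move=> k; apply: (Ck_comp oU' _ (sh k)); first by move=> y [].
  by apply: Ck_subset (sg k) => y [].
- by move=> y [Uy _] Ay /=; rewrite gf.
Qed.

Lemma smooth_atV V (A : set V) (f : V -> R^o) x :
  A x -> f x != 0 -> smooth_at A f x -> smooth_at A (fun y => (f y)^-1 : R^o) x.
Proof. by move=> Ax fx; apply: smooth_at_comp (@openR_neq0 R) Cinfty_inv Ax fx. Qed.

Lemma smooth_at_sqrt V (A : set V) (f : V -> R^o) x :
  A x -> 0 < f x -> smooth_at A f x -> smooth_at A (fun y => Num.sqrt (f y) : R^o) x.
Proof.
by move=> Ax fx; apply: smooth_at_comp Cinfty_sqrt Ax fx; exact: open_gt.
Qed.

Lemma smooth_at_sin V (A : set V) (f : V -> R^o) x :
  A x -> smooth_at A f x -> smooth_at A (fun y => sin (f y) : R^o) x.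
Proof. by move=> Ax; apply: smooth_at_comp openT Cinfty_sin_cos.1 Ax I. Qed.

Lemma smooth_at_cos V (A : set V) (f : V -> R^o) x :
  A x -> smooth_at A f x -> smooth_at A (fun y => cos (f y) : R^o) x.
Proof. by move=> Ax; apply: smooth_at_comp openT Cinfty_sin_cos.2 Ax I. Qed.

Lemma smooth_at_atan V (A : set V) (f : V -> R^o) x :
  A x -> smooth_at A f x -> smooth_at A (fun y => atan (f y) : R^o) x.
Proof. by move=> Ax; apply: smooth_at_comp openT Cinfty_atan Ax I. Qed.

Lemma smooth_at_id V (A : set V) x : smooth_at A id x.
Proof.
exists setT, id; split => //; first exact: openT.
case=> [|k] /=; first by move=> y _; exact: cvg_id.
split=> [y _|v]; first by case: (is_diff_id y).
have -> : (fun x : V => 'D_v id x) = cst v by apply/funext => y; exact: derive_id.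
exact: Ck_cst.
Qed.

Lemma smooth_at_fst V W W' (A : set V) (f : V -> W * W') x :
  smooth_at A f x -> smooth_at A (fun y => (f y).1) x.
Proof. by apply: smooth_at_lin => // y; exact: cvg_fst. Qed.

Lemma smooth_at_snd V W W' (A : set V) (f : V -> W * W') x :
  smooth_at A f x -> smooth_at A (fun y => (f y).2) x.
Proof. by apply: smooth_at_lin => // y; exact: cvg_snd. Qed.

Lemma smooth_at_pair V W W' (A : set V) (f : V -> W) (g : V -> W') x :
  smooth_at A f x -> smooth_at A g x -> smooth_at A (fun y => (f y, g y)) x.
Proof.
move=> sf sg.
apply: (@smooth_at_eq _ _ _ (fun y => ((f y, 0) : W * W') + ((0, g y) : W * W'))).
  by move=> y _; rewrite -[LHS]/(f y + 0, 0 + g y) addr0 add0r.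
apply: smooth_atD.
  apply: (@smooth_at_lin _ _ _ _ (fun w : W => (w, 0) : W * W')) sf.
    by move=> k u v; rewrite -[RHS]/(k *: u + v, k *: 0 + 0) scaler0 addr0.
  move=> w; apply: (@cvg_pair _ _ _ _ (nbhs w) (nbhs (0 : W'))).
    exact: cvg_id.
  exact: cvg_cst.
apply: (@smooth_at_lin _ _ _ _ (fun w : W' => (0, w) : W * W')) sg.
  by move=> k u v; rewrite -[RHS]/(k *: 0 + 0, k *: u + v) scaler0 addr0.
by move=> w; apply: cvg_pair; [exact: cvg_cst|exact: cvg_id].
Qed.

Lemma smooth_at_coord V n (A : set V) (f : V -> 'rV[R]_n) i x :
  smooth_at A f x -> smooth_at A (fun y => f y 0 i : R^o) x.
Proof.
apply: (@smooth_at_lin _ _ R^o _ (fun w : 'rV[R]_n => w 0 i : R^o)).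
  by move=> k u v; rewrite !mxE.
exact: coord_continuous.
Qed.

Lemma smooth_atZ V W (A : set V) (f : V -> R^o) (w : W) x :
  smooth_at A f x -> smooth_at A (fun y => f y *: w) x.
Proof.
apply: (@smooth_at_lin _ R^o _ _ (fun t : R^o => t *: w)).
  by move=> k u v; rewrite scalerDl scalerA.
exact: scalel_continuous.
Qed.

Lemma smooth_at_row V n (A : set V) (f : V -> 'rV[R]_n) x :
  (forall i, smooth_at A (fun y => f y 0 i : R^o) x) -> smooth_at A f x.
Proof.
move=> sf.
apply: (@smooth_at_eq _ _ _ (fun y => \sum_(i < n) f y 0 i *: delta_mx 0 i)).
  by move=> y _; rewrite -row_sum_delta.
by apply: smooth_at_sum => i; exact: smooth_atZ.
Qed.

End smooth_at.

(** * Continuous angles on star-shaped sets *)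

Section angle.
Context {R : realType}.
Implicit Types c s t : R.

(** The angle from the unit vector [(c, s)] to [(c', s')], which is continuous in
    both as long as their inner product stays positive. *)
Definition angle_step c s c' s' : R := atan ((s' * c - c' * s) / (c' * c + s' * s)).

Lemma angle_step_id c s : angle_step c s c s = 0.
Proof. by rewrite /angle_step [s * c]mulrC subrr mul0r atan0. Qed.

Lemma angle_stepP t c s c' s' : cos t = c -> sin t = s ->
  c' ^+ 2 + s' ^+ 2 = 1 -> 0 < c' * c + s' * s ->
  cos (t + angle_step c s c' s') = c' /\ sin (t + angle_step c s c' s') = s'.
Proof.
move=> tc ts u' re0; have u : c ^+ 2 + s ^+ 2 = 1 by rewrite -tc -ts cos2Dsin2.
rewrite /angle_step; set re := _ + _ in re0 *; set im := _ - _.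
have reim : re ^+ 2 + im ^+ 2 = 1.
  rewrite -[1]mulr1 -{1}u -u' /re /im; ring.
have re_neq0 : re != 0 by rewrite gt_eqF.
have ct : cos (atan (im / re)) = re.
  rewrite cos_atan.
  have -> : 1 + (im / re) ^+ 2 = re^-1 ^+ 2.
    transitivity ((re ^+ 2 + im ^+ 2) / re ^+ 2); last by rewrite reim mul1r exprVn.
    by field.
  by rewrite sqrtr_sqr ger0_norm ?invrK// invr_ge0 ltW.
have st : sin (atan (im / re)) = im.
  have := atanK (im / re); rewrite /tan ct => /(congr1 (fun x => x * re)).
  by rewrite !divfK.
rewrite cosD sinD tc ts ct st /re /im; split.
  rewrite -[RHS]mulr1 -u; ring.
rewrite -[RHS]mulr1 -u; ring.
Qed.

Lemma cos1_eq0 t : `|t| < pi -> cos t = 1 -> t = 0.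
Proof.
move=> tpi ct; apply/eqP; rewrite -normr_eq0; apply/eqP.
apply: cos_inj; rewrite ?in_itv/= ?lexx ?normr_ge0 ?pi_ge0 ?(ltW tpi)//.
rewrite cos0; case: (ler0P t) => _ //; by rewrite cosN.
Qed.

Lemma unit_angle c s : c ^+ 2 + s ^+ 2 = 1 -> exists t, cos t = c /\ sin t = s.
Proof.
move=> u; have c1 : -1 <= c <= 1.
  by apply/andP; split; nra.
have ca := @acosK _ c c1.
have sa : sin (acos c) = `|s|.
  by rewrite sin_acos// -sqrtr_sqr; congr Num.sqrt; rewrite -u; ring.
case: (ger0P s) sa => _ sa; first by exists (acos c).
by exists (- acos c); rewrite cosN sinN sa opprK.
Qed.

(** An angle that varies continuously and only by multiples of a full turn
    cannot reach the half turns, so it does not vary at all. *)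
Lemma full_turns_constant (d : R -> R) :
  (forall s, 0 <= s <= 1 -> {for s, continuous d}) ->
  (forall s, 0 <= s <= 1 -> cos (d s - d 0) = 1) -> d 1 = d 0.
Proof.
move=> cd d1; pose f := d \- cst (d 0).
have cf : {within `[0 : R, 1], continuous f}.
  apply: continuous_in_subspaceT => s /[!inE]/=; rewrite in_itv/= => s01.
  by apply: cvgB; [exact: cd|exact: cst_continuous].
have f0 : f 0 = 0 by rewrite /f /= subrr.
have fpi v : `|v| = pi -> Num.min (f 0) (f 1) <= v <= Num.max (f 0) (f 1) -> False.
  move=> vpi /(IVT ler01 cf)[s]; rewrite in_itv/= => s01 fs.
  have := d1 s s01; rewrite -[d s - d 0]/(f s) fs.
  have -> : cos v = cos `|v| by case: (ler0P v) => _ //; rewrite cosN.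
  by rewrite vpi cospi; lra.
apply/eqP; rewrite -subr_eq0 -[d 1 - d 0]/(f 1); apply/eqP/cos1_eq0; last first.
  by apply: d1; rewrite ler01 lexx.
rewrite ltNge; apply/negP => pif; have p0 := pi_ge0 R.
case: (ler0P (f 1)) pif => f1 pif.
  apply: (fpi (- pi)); first by rewrite normrN ger0_norm.
  by rewrite f0 ge_min le_max oppr_le0 p0 andbT; apply/orP; right; lra.
apply: (fpi pi); first by rewrite ger0_norm.
by rewrite f0 ge_min le_max p0 /= pif orbT.
Qed.

End angle.

Section star_lift.
Context {R : realType} {V : normedModType R}.

(** [phi] lifts the circle-valued map [(C, S)] through the universal covering of
    the circle. *)
Definition lift_on (Om : set V) (C S phi : V -> R) : Prop := forall w, Om w ->
  [/\ {for w, continuous phi}, cos (phi w) = C w & sin (phi w) = S w].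

Definition seg (w0 w : V) (s : R) : V := w0 + s *: (w - w0).

Lemma seg0 w0 w : seg w0 w 0 = w0.
Proof. by rewrite /seg scale0r addr0. Qed.

Lemma seg1 w0 w : seg w0 w 1 = w.
Proof. by rewrite /seg scale1r addrC subrK. Qed.

Lemma seg_continuous (T : topologicalType) w0 (a : T -> R) (b : T -> V) (x : T) :
  {for x, continuous a} -> {for x, continuous b} ->
  {for x, continuous (fun y => seg w0 (b y) (a y))}.
Proof.
move=> ca cb; apply: cvgD; first exact: cvg_cst.
by apply: cvgZ => //; apply: cvgB => //; exact: cvg_cst.
Qed.

Lemma subdiv01 n k (s : R) : 0 <= s <= 1 -> (k <= n)%N -> (0 < n)%N ->
  0 <= s * (k%:R / n%:R) <= 1.
Proof.
move=> /andP[s0 s1] kn n0; have kn1 : k%:R / n%:R <= 1 :> R.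
  by rewrite ler_pdivrMr ?ltr0n// mul1r ler_nat.
have kn0 : 0 <= k%:R / n%:R :> R by rewrite divr_ge0.
by rewrite mulr_ge0//= mulr_ile1.
Qed.

(** Two continuous angles of the same circle-valued map differ by a locally
    constant multiple of a full turn. *)
Lemma lift_diff_constant (Om1 Om2 : set V) (C S phi1 phi2 : V -> R) w0 w1 :
  lift_on Om1 C S phi1 -> lift_on Om2 C S phi2 ->
  (forall s, 0 <= s <= 1 -> Om1 (seg w0 w1 s) /\ Om2 (seg w0 w1 s)) ->
  phi1 w1 - phi2 w1 = phi1 w0 - phi2 w0.
Proof.
move=> l1 l2 sOm; pose d s := phi1 (seg w0 w1 s) - phi2 (seg w0 w1 s).
have := @full_turns_constant _ d; rewrite /d seg1 seg0; apply=> s s01.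
  have cs : {for s, continuous (seg w0 w1)}.
    by apply: seg_continuous; [exact: cvg_id|exact: cvg_cst].
  have [Q1 Q2] := sOm s s01; have [c1 _ _] := l1 _ Q1; have [c2 _ _] := l2 _ Q2.
  by apply: cvgB; [exact: (continuous_comp cs c1)|exact: (continuous_comp cs c2)].
have [Q1 Q2] := sOm s s01.
have [|P1 P2] := sOm 0; first by rewrite lexx ler01.
rewrite seg0 in P1 P2.
have [_ c1 s1] := l1 _ Q1; have [_ c2 s2] := l2 _ Q2.
have [_ c3 s3] := l1 _ P1; have [_ c4 s4] := l2 _ P2.
rewrite cosB !cosB !sinB c1 s1 c2 s2 c3 s3 c4 s4.
have u1 : C (seg w0 w1 s) ^+ 2 + S (seg w0 w1 s) ^+ 2 = 1 by rewrite -c1 -s1 cos2Dsin2.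
have u0 : C w0 ^+ 2 + S w0 ^+ 2 = 1 by rewrite -c3 -s3 cos2Dsin2.
by rewrite -!expr2 u1 u0 mulr1 [C _ * S _]mulrC subrr mul0r addr0.
Qed.

Variables (Om : set V) (w0 : V) (C S : V -> R).
Hypothesis Om_open : open Om.
Hypothesis Om_star : forall w s, Om w -> 0 <= s <= 1 -> Om (seg w0 w s).
Hypothesis C_cont : forall w, Om w -> {for w, continuous C}.
Hypothesis S_cont : forall w, Om w -> {for w, continuous S}.
Hypothesis CS1 : forall w, Om w -> C w ^+ 2 + S w ^+ 2 = 1.

Let cosd w w' := C w' * C w + S w' * S w.

(** A Lebesgue number for the segment from [w0] to [w] that remains valid for
    all nearby end points, by compactness of the parameter interval. *)
Lemma fine_subdivision w : Om w -> exists n : nat, (0 < n)%N /\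
  \forall w' \near w, forall s, 0 <= s <= 1 -> forall k, (k < n)%N ->
    0 < cosd (seg w0 w' (s * (k%:R / n%:R))) (seg w0 w' (s * (k.+1%:R / n%:R))).
Proof.
move=> Omw.
have cpt : near_covering `[0 : R, 1]%classic.
  by apply/compact_near_coveringP; exact: segment_compact.
(* The filter parameter is a pair: the increment [i.1] of the time along the
   segment, near 0, and the end point [i.2] of the segment, near [w]. *)
pose P (i : R * V) (t : R) := 0 < cosd (seg w0 i.2 t) (seg w0 i.2 (t + i.1)).
have tube : \forall i \near nbhs (0 : R, w), `[0, 1]%classic `<=` P i.
  apply: cpt => t; rewrite /= in_itv/= => t01; rewrite /P.
  have Ot : Om (seg w0 w t) by exact: Om_star.
  pose x0 : R * (R * V) := (t, (0, w)).
  have c1 : {for x0, continuous (fun x : R * (R * V) => seg w0 x.2.2 x.1)}.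
    apply: seg_continuous; first exact: cvg_fst.
    by apply: (cvg_comp _ _ cvg_snd); exact: cvg_snd.
  have c2 : {for x0, continuous (fun x : R * (R * V) => seg w0 x.2.2 (x.1 + x.2.1))}.
    apply: seg_continuous; last by apply: (cvg_comp _ _ cvg_snd); exact: cvg_snd.
    apply: cvgD; first exact: cvg_fst.
    by apply: (cvg_comp _ _ cvg_snd); exact: cvg_fst.
  have e2 : seg w0 w (t + 0) = seg w0 w t by rewrite addr0.
  have cF : {for x0, continuous (fun x : R * (R * V) =>
      cosd (seg w0 x.2.2 x.1) (seg w0 x.2.2 (x.1 + x.2.1)))}.
    apply: cvgD; apply: cvgM.
    - by apply: (continuous_comp c2); rewrite /= e2; exact: C_cont.
    - by apply: (continuous_comp c1); exact: C_cont.
    - by apply: (continuous_comp c2); rewrite /= e2; exact: S_cont.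
    - by apply: (continuous_comp c1); exact: S_cont.
  have F0 : 0 < cosd (seg w0 w t) (seg w0 w (t + 0)).
    by rewrite e2 /cosd -!expr2 CS1.
  by apply: (cF [set y : R | 0 < y]); apply: open_nbhs_nbhs; split=> //; exact: open_gt.
have [[A B] [/= [d /= d0 dA] nB] AB] := tube.
have [n nd] : exists n : nat, n.+1%:R^-1 < d.
  exists (Num.truncn d^-1); rewrite -[ltRHS]invrK ltf_pV2 ?posrE ?invr_gt0//.
  exact: truncnS_gt.
exists n.+1; split=> //; near=> w'; move=> s /andP[s0 s1] k kn.
have n0 : 0 < n.+1%:R :> R by rewrite ltr0n.
have -> : s * (k.+1%:R / n.+1%:R) = s * (k%:R / n.+1%:R) + s / n.+1%:R.
  by rewrite -natr1; field; rewrite gt_eqF.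
apply: (AB (s / n.+1%:R, w')); last first.
  by rewrite /= in_itv/= subdiv01 ?s0//; exact: ltnW.
split=> /=; last by near: w'.
apply: dA; rewrite /= sub0r normrN ger0_norm; last by rewrite divr_ge0.
apply: le_lt_trans nd; rewrite ler_pdivrMr// mulVf// gt_eqF//.
Unshelve. all: by end_near. Qed.

(** The angle is transported along the segment from [w0] in [n] steps, each too
    short for the angular increment to be ambiguous; the value at the end does
    not depend on [n], because two continuous choices of angle along a segment
    differ by a constant. *)
Lemma star_lift : Om w0 -> exists phi : V -> R, lift_on Om C S phi.
Proof.
move=> Om0; have [t0 [t0c t0s]] := unit_angle (CS1 Om0).
pose psi n (w : V) (s : R) : R := t0 + \sum_(k < n)
  angle_step (C (seg w0 w (s * (k%:R / n%:R)))) (S (seg w0 w (s * (k%:R / n%:R))))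
    (C (seg w0 w (s * (k.+1%:R / n%:R)))) (S (seg w0 w (s * (k.+1%:R / n%:R)))).
pose fine n (w : V) := (0 < n)%N /\
  (Om w /\ forall s : R, 0 <= s <= 1 -> forall k, (k < n)%N ->
    0 < cosd (seg w0 w (s * (k%:R / n%:R))) (seg w0 w (s * (k.+1%:R / n%:R)))).
have psi_lift n w s : fine n w -> 0 <= s <= 1 ->
    cos (psi n w s) = C (seg w0 w s) /\ sin (psi n w s) = S (seg w0 w s).
  move=> [n0 [Omw fw]] s01.
  suff H m : (m <= n)%N -> let p := t0 + \sum_(k < m)
      angle_step (C (seg w0 w (s * (k%:R / n%:R)))) (S (seg w0 w (s * (k%:R / n%:R))))
    (C (seg w0 w (s * (k.+1%:R / n%:R)))) (S (seg w0 w (s * (k.+1%:R / n%:R)))) in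
    cos p = C (seg w0 w (s * (m%:R / n%:R))) /\ sin p = S (seg w0 w (s * (m%:R / n%:R))).
    by have := H n (leqnn n); rewrite divff ?mulr1// pnatr_eq0 -lt0n.
  elim: m => [_|m IH mn] /=.
    by rewrite big_ord0 addr0 mul0r mulr0 seg0.
  have [pc ps] := IH (ltnW mn); rewrite big_ord_recr/= addrA.
  apply: angle_stepP => //; last exact: fw.
  by apply/CS1/Om_star => //; exact: subdiv01.
(* Joint statement for both uses below: continuity in the time along a fixed
   segment, and continuity in the end point. *)
have step_cont (T : topologicalType) (a b : T -> V) (x : T) : Om (a x) -> Om (b x) ->
    0 < cosd (a x) (b x) -> {for x, continuous a} -> {for x, continuous b} ->
    {for x, continuous (fun y => angle_step (C (a y)) (S (a y)) (C (b y)) (S (b y)))}.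
  move=> Oa Ob ab ca cb.
  have cCa : {for x, continuous (C \o a)} by apply: (continuous_comp ca); exact: C_cont.
  have cSa : {for x, continuous (S \o a)} by apply: (continuous_comp ca); exact: S_cont.
  have cCb : {for x, continuous (C \o b)} by apply: (continuous_comp cb); exact: C_cont.
  have cSb : {for x, continuous (S \o b)} by apply: (continuous_comp cb); exact: S_cont.
  apply: (@continuous_comp _ _ _ (fun y =>
    (S (b y) * C (a y) - C (b y) * S (a y)) / (C (b y) * C (a y) + S (b y) * S (a y)))
    (@atan R) x); last exact: continuous_atan.
  apply: cvgM.
    by apply: cvgB; apply: cvgM; [exact: cSb|exact: cCa|exact: cCb|exact: cSa].
  apply: cvgV; first by rewrite gt_eqF.
  by apply: cvgD; apply: cvgM; [exact: cCb|exact: cCa|exact: cSb|exact: cSa].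
have sum_cont (T : topologicalType) m (f : 'I_m -> T -> R) (x : T) :
    (forall k, {for x, continuous (f k)}) ->
    {for x, continuous (fun y => t0 + \sum_(k < m) f k y)}.
  move=> cf; suff cs : {for x, continuous (fun y => \sum_(k < m) f k y)}.
    by apply: cvgD; [exact: cvg_cst|exact: cs].
  elim: m f cf => [|m IH] f cf.
    have -> : (fun y => \sum_(k < 0) f k y) = cst 0 by apply/funext=> y; rewrite big_ord0.
    exact: cst_continuous.
  have -> : (fun y => \sum_(k < m.+1) f k y) =
      (fun y => f ord0 y + \sum_(k < m) f (lift ord0 k) y).
    by apply/funext=> y; rewrite big_ord_recl.
  by apply: cvgD; [exact: cf|apply: IH => k; exact: cf].
have psi_s n w s : fine n w -> 0 <= s <= 1 -> {for s, continuous (psi n w)}.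
  move=> [n0 [Omw fw]] s01; apply: sum_cont => k.
  have cs r : {for s, continuous (fun u : R => seg w0 w (u * r))}.
    apply: seg_continuous; last exact: cvg_cst.
    by apply: cvgM; [exact: cvg_id|exact: cvg_cst].
  apply: step_cont => //; [| |exact: fw].
    by apply: Om_star => //; apply: subdiv01 => //; exact: ltnW.
  by apply: Om_star => //; exact: subdiv01.
have psi_w n w : fine n w -> {for w, continuous (fun w => psi n w 1)}.
  move=> [n0 [Omw fw]]; have s01 : 0 <= (1 : R) <= 1 by rewrite ler01 lexx.
  apply: sum_cont => k.
  have cs r : {for w, continuous (fun u : V => seg w0 u r)}.
    by apply: seg_continuous; [exact: cvg_cst|exact: cvg_id].
  apply: step_cont => //; [| |exact: fw].
    by apply: Om_star => //; apply: subdiv01 => //; exact: ltnW.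
  by apply: Om_star => //; exact: subdiv01.
have psi_uniq n m w : fine n w -> fine m w -> psi n w 1 = psi m w 1.
  move=> fn fm; have z01 : 0 <= (0 : R) <= 1 by rewrite ler01 lexx.
  have psi0 j : psi j w 0 = t0.
    rewrite /psi big1 ?addr0// => k _.
    by rewrite !mul0r seg0 angle_step_id.
  pose d s := psi n w s - psi m w s.
  have dE : d 1 = d 0.
    apply: full_turns_constant => s s01.
      by apply: cvgB; exact: psi_s.
    have [c1 s1] := psi_lift _ _ _ fn s01; have [c2 s2] := psi_lift _ _ _ fm s01.
    rewrite /d !psi0 subrr subr0 cosB c1 c2 s1 s2 -!expr2 CS1//.
    by apply: Om_star => //; case: fn => _ [].
  by apply/eqP; rewrite -subr_eq0 -/(d 1) dE /d !psi0 subrr.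
(* The number of steps may be chosen separately at each point, without any
   coherence, because of [psi_uniq]. *)
have fineE w : Om w -> exists n, \forall w' \near w, fine n w'.
  move=> Omw; have [n [n0 fn]] := fine_subdivision Omw.
  have nO : nbhs w Om by exact: open_nbhs_nbhs.
  by exists n; near=> w'; split=> //; split; near: w'.
have [nu nuP] : {nu : V -> nat & forall w, Om w -> \forall w' \near w, fine (nu w) w'}.
  exists (fun w => xget 0%N [set n | \forall w' \near w, fine n w']) => w Omw.
  by case: xgetP => [n _ //|]; have [n fn] := fineE w Omw => /(_ n).
exists (fun w => psi (nu w) w 1) => w Omw.
have fw : fine (nu w) w by apply: nbhs_singleton; exact: nuP.
have o01 : 0 <= (1 : R) <= 1 by rewrite ler01 lexx.
have [pc ps] := psi_lift _ _ _ fw o01; rewrite seg1 in pc ps; split=> //.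
apply: cvg_trans (psi_w _ _ fw); apply: near_eq_cvg.
have nO : nbhs w Om by exact: open_nbhs_nbhs.
apply: filterS2 (nuP w Omw) nO => w' fw' Ow'; apply: psi_uniq => //.
exact: nbhs_singleton (nuP w' Ow').
Unshelve. all: by end_near. Qed.

End star_lift.

(** * Euclidean geometry in dimensions three and four *)

Section euclidean_algebra.
Context {R : realType}.

Lemma dotC n (u w : 'rV[R]_n) : dot u w = dot w u.
Proof. by apply: eq_bigr => i _; rewrite mulrC. Qed.

Lemma dotDl n (u v w : 'rV[R]_n) : dot (u + v) w = dot u w + dot v w.
Proof. by rewrite /dot -big_split; apply: eq_bigr => i _; rewrite mxE mulrDl. Qed.

Lemma dotZl n a (u w : 'rV[R]_n) : dot (a *: u) w = a * dot u w.
Proof. by rewrite /dot mulr_sumr; apply: eq_bigr => i _; rewrite mxE mulrA. Qed.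

Lemma dotDr n (u v w : 'rV[R]_n) : dot w (u + v) = dot w u + dot w v.
Proof. by rewrite dotC dotDl !(dotC w). Qed.

Lemma dotZr n a (u w : 'rV[R]_n) : dot w (a *: u) = a * dot w u.
Proof. by rewrite dotC dotZl dotC. Qed.

Lemma dot_comb n a b c d (u w : 'rV[R]_n) :
  dot (a *: u + b *: w) (c *: u + d *: w) =
  a * c * dot u u + (a * d + b * c) * dot u w + b * d * dot w w.
Proof. rewrite !dotDl !dotDr !dotZl !dotZr (dotC w u); ring. Qed.

Lemma dot_ge0 n (u : 'rV[R]_n) : 0 <= dot u u.
Proof. by apply: sumr_ge0 => i _; rewrite -expr2 sqr_ge0. Qed.

Lemma dot_eq0 n (u : 'rV[R]_n) : (dot u u == 0) = (u == 0).
Proof.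
apply/idP/eqP => [|->]; last by rewrite /dot big1// => i _; rewrite mxE mul0r.
rewrite /dot psumr_eq0 => [/allP u0|i _]; last by rewrite -expr2 sqr_ge0.
apply/rowP => i; have := u0 i; rewrite mem_index_enum mulf_eq0 orbb mxE.
by move=> /(_ isT)/eqP.
Qed.

Lemma sqr_enorm n (u : 'rV[R]_n) : enorm u ^+ 2 = dot u u.
Proof. by rewrite sqr_sqrtr// dot_ge0. Qed.

Lemma dot3E (u w : 'rV[R]_3) : dot u w = u 0 0 * w 0 0 + u 0 1 * w 0 1 + u 0 2 * w 0 2.
Proof.
rewrite /dot !big_ord_recl big_ord0 addr0 addrA.
by congr (_ + _ * _ + _ * _); congr (_ 0 _); apply: val_inj.
Qed.

Lemma ord3P (P : 'I_3 -> Prop) : P 0 -> P 1 -> P 2 -> forall i, P i.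
Proof.
move=> P0 P1 P2 [[|[|[|//]]] ilt].
- by rewrite (_ : Ordinal ilt = 0)//; exact: val_inj.
- by rewrite (_ : Ordinal ilt = 1)//; exact: val_inj.
- by rewrite (_ : Ordinal ilt = 2)//; exact: val_inj.
Qed.

Lemma row3P (u w : 'rV[R]_3) :
  u 0 0 = w 0 0 -> u 0 1 = w 0 1 -> u 0 2 = w 0 2 -> u = w.
Proof. by move=> u0 u1 u2; apply/rowP; exact: ord3P. Qed.

Lemma row3_neq0 (a : 'rV[R]_3) :
  a != 0 -> [|| a 0 0 != 0, a 0 1 != 0 | a 0 2 != 0].
Proof.
apply: contraNT; rewrite !negb_or !negbK => /and3P[/eqP a0 /eqP a1 /eqP a2].
by apply/eqP/row3P; rewrite mxE.
Qed.

Lemma crossE (u w : 'rV[R]_3) :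
  (cross u w 0 0 = u 0 1 * w 0 2 - u 0 2 * w 0 1) *
  (cross u w 0 1 = u 0 2 * w 0 0 - u 0 0 * w 0 2) *
  (cross u w 0 2 = u 0 0 * w 0 1 - u 0 1 * w 0 0).
Proof. by rewrite !mxE. Qed.

Lemma sca_quat a (u : 'rV[R]_3) : sca (quat a u) = a.
Proof. by rewrite /sca /quat row_mxKl mxE eqxx. Qed.

Lemma vec_quat a (u : 'rV[R]_3) : vec (quat a u) = u.
Proof. by rewrite /vec /quat row_mxKr. Qed.

Lemma quatK (q : 'rV[R]_4) : quat (sca q) (vec q) = q.
Proof.
rewrite /quat /sca /vec.
have -> : (lsubmx (q : 'rV_(1 + 3)) 0 0)%:M = lsubmx (q : 'rV_(1 + 3)).
  by apply/rowP => i; rewrite ord1 !mxE eqxx.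
exact: (@hsubmxK R 1 1 3 q).
Qed.

Lemma quat_eq (q v : 'rV[R]_4) : sca q = sca v -> vec q = vec v -> q = v.
Proof. by move=> s e; rewrite -(quatK q) s e quatK. Qed.

Lemma scaD (q v : 'rV[R]_4) : sca (q + v) = sca q + sca v.
Proof. by rewrite /sca !mxE. Qed.

Lemma scaZ a (q : 'rV[R]_4) : sca (a *: q) = a * sca q.
Proof. by rewrite /sca !mxE. Qed.

Lemma vecD (q v : 'rV[R]_4) : vec (q + v) = vec q + vec v.
Proof. by apply/rowP => i; rewrite !mxE. Qed.

Lemma vecZ a (q : 'rV[R]_4) : vec (a *: q) = a *: vec q.
Proof. by apply/rowP => i; rewrite !mxE. Qed.

Lemma dot4E (q v : 'rV[R]_4) : dot q v = sca q * sca v + dot (vec q) (vec v).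
Proof.
rewrite /dot (@big_split_ord _ _ _ 1 3) big_ord_recl big_ord0 /= addr0 /sca /vec.
congr (_ + _); first by rewrite !mxE.
by apply: eq_bigr => i _; rewrite !mxE.
Qed.

(** The right-hand side depends on [x] and [y] through the bivector [x /\ y]
    alone and linearly, so vectors with proportional bivectors have proportional
    contractions. *)
Lemma contraction (x y w : 'rV[R]_4) :
  dot x w *: y - dot y w *: x =
  quat (- dot (momentum (x, y)).2 (vec w))
       (sca w *: (momentum (x, y)).2 + cross (momentum (x, y)).1 (vec w)).
Proof.
rewrite /momentum /=; apply: quat_eq.
  rewrite sca_quat scaD -scaleN1r !scaZ !dot4E !dot3E !mxE; ring.
by rewrite vec_quat vecD -scaleN1r !vecZ !dot4E; apply: row3P;
  rewrite !mxE ?crossE/= !dot3E !mxE/=; ring.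
Qed.

Lemma momentum_comb a b c d (u w : 'rV[R]_4) :
  momentum (a *: u + b *: w, c *: u + d *: w) =
  ((a * d - b * c) *: (momentum (u, w)).1, (a * d - b * c) *: (momentum (u, w)).2).
Proof.
rewrite /momentum /= !scaD !scaZ !vecD !vecZ.
by congr (_, _); apply: row3P; rewrite !mxE/= ?mxE; ring.
Qed.

(** A unit vector [x] and a vector [y] orthogonal to it are recovered from
    [x /\ y] by contracting with [y] and [x], up to the two inner products of
    [x] with the frame; these form a unit vector because [x] does. *)
Lemma wedge_rotation (x y al be : 'rV[R]_4) (n : R) :
  dot al al = 1 -> dot be be = 1 -> dot al be = 0 -> 0 < n ->
  dot x x = 1 -> dot x y = 0 -> y != 0 ->
  momentum (x, y) = (n *: (momentum (al, be)).1, n *: (momentum (al, be)).2) ->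
  [/\ x = dot al x *: al + dot be x *: be,
      y = n *: (- dot be x *: al + dot al x *: be) &
      dot be x ^+ 2 + dot al x ^+ 2 = 1].
Proof.
move=> aa bb ab n0 xx xy yn0 m.
have F w : dot x w *: y - dot y w *: x = n *: (dot al w *: be - dot be w *: al).
  rewrite !contraction m; case: (momentum (al, be)) => M L /=; apply: quat_eq.
    by rewrite scaZ !sca_quat dotZl mulrN.
  by rewrite vecZ !vec_quat; apply: row3P; rewrite !mxE/= ?mxE; ring.
(* Contracting with [x] expresses [y] in the frame, and contracting with [y]
   expresses [x]. *)
set s := dot al x; set c := dot be x.
have yE : y = n *: (- c *: al + s *: be).
  have := F x; rewrite xx (dotC y) xy scale0r subr0 scale1r => ->.
  by rewrite scaleNr addrC.
have ay : dot al y = - (n * c).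
  by rewrite yE dotZr dotDr !dotZr aa ab mulr0 addr0 mulr1 mulrN.
have bey : dot be y = n * s.
  by rewrite yE dotZr dotDr !dotZr bb (dotC be) ab mulr0 add0r mulr1.
have yy : dot y y = n ^+ 2 * (c ^+ 2 + s ^+ 2).
  rewrite {1}yE dotZl dotDl !dotZl ay bey; ring.
have n2 : n ^+ 2 != 0 by rewrite expf_neq0// gt_eqF.
have Nx : (c ^+ 2 + s ^+ 2) *: x = s *: al + c *: be.
  apply: (scalerI n2); rewrite scalerA; apply: oppr_inj.
  have := F y; rewrite xy scale0r sub0r yy ay bey => ->.
  by apply/rowP => i; rewrite !mxE; ring.
(* The squared norm of [Nx] leaves only the values 0 and 1 for this sum, and 0
   would make [y] vanish. *)
have N1 : c ^+ 2 + s ^+ 2 = 1.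
  have NN : (c ^+ 2 + s ^+ 2) * (c ^+ 2 + s ^+ 2) = c ^+ 2 + s ^+ 2.
    have := congr1 (fun z => dot z ((c ^+ 2 + s ^+ 2) *: x)) Nx.
    rewrite /= {3}Nx dotZl dotZr xx mulr1 => ->.
    rewrite dotDl !dotZl !dotDr !dotZr aa bb ab (dotC be) ab; ring.
  have : (c ^+ 2 + s ^+ 2) * (c ^+ 2 + s ^+ 2 - 1) = 0 by rewrite mulrBr mulr1 NN subrr.
  move=> /eqP; rewrite mulf_eq0 subr_eq0; case/orP => /eqP // N0.
  by case/negP: yn0; rewrite -dot_eq0 yy N0 mulr0.
by split=> //; rewrite -Nx N1 scale1r.
Qed.

End euclidean_algebra.

(** * Continuous angles on punctured three-space *)

Section punctured_lift.
Context {R : realType} {W : normedModType R}.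
Notation V := ('rV[R]_3 * W)%type.
Implicit Types w : V.

Definition pt (x y z : R) : V := (\row_(i < 3) [:: x; y; z]`_i, 0).

Lemma ptE x y z : ((pt x y z).1 0 0 = x) * ((pt x y z).1 0 1 = y) * ((pt x y z).1 0 2 = z).
Proof. by rewrite !mxE. Qed.

Lemma seg_coord w0 w s i : (seg w0 w s).1 0 i = w0.1 0 i + s * (w.1 0 i - w0.1 0 i).
Proof. by rewrite /seg/= !mxE. Qed.

Lemma coord_cont i : continuous (fun w : V => w.1 0 i : R).
Proof.
move=> w; apply: (@cvg_comp _ _ _ (fun w : V => w.1) (fun a : 'rV[R]_3 => a 0 i : R)).
  exact: cvg_fst.
exact: coord_continuous.
Qed.

(** The complement of the half-axis opposite to [eps] in the third direction. *)
Let cut (eps : R) : set V :=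
  [set w : V | w.1 0 0 != 0] `|` [set w : V | w.1 0 1 != 0]
  `|` [set w : V | 0 < eps * w.1 0 2].

Let cutE eps w : cut eps w =
  ((w.1 0 0 != 0 \/ w.1 0 1 != 0) \/ 0 < eps * w.1 0 2) :> Prop.
Proof. by []. Qed.

Let cut_open eps : open (cut eps).
Proof.
have oc i (U : set R) : open U -> open [set w : V | U (w.1 0 i)].
  by move=> oU; apply: open_comp => // w _; exact: coord_cont.
apply: openU; first by apply: openU; apply: (oc _ [set x | x != 0]); exact: openR_neq0.
apply: (@open_comp V R (fun w => eps * w.1 0 2) [set x | 0 < x]); last exact: open_gt.
by move=> w _; apply: cvgM; [exact: cvg_cst|exact: coord_cont].
Qed.

(* On the segment from the centre the first two coordinates are scaled, and
   [eps] times the third moves from 1 to its end value. *)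
Let cut_star eps w s : eps ^+ 2 = 1 -> cut eps w -> 0 <= s <= 1 ->
  cut eps (seg (pt 0 0 eps) w s).
Proof.
move=> eps1 + /andP[s0 s1]; rewrite !cutE !seg_coord !ptE !add0r !subr0.
case: (eqVneq s 0) => [->|sn0].
  by move=> _; right; rewrite mul0r addr0 -expr2 eps1.
move=> [[|]|] h; first by left; left; rewrite mulf_neq0.
  by left; right; rewrite mulf_neq0.
right; have -> : eps * (eps + s * (w.1 0 2 - eps)) =
    (1 - s) * eps ^+ 2 + s * (eps * w.1 0 2) by ring.
rewrite eps1 mulr1; apply: ltr_wpDl; first by rewrite subr_ge0.
by rewrite mulr_gt0// lt_neqAle eq_sym sn0.
Qed.

(** The complement of the third axis is not convex, but each of its points can
    be joined by a segment to a corner of a square around the axis, and so can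
    adjacent corners. *)
Let lift_diff_off_axis (C S phi1 phi2 : V -> R) e1 e2 w :
  lift_on (cut e1) C S phi1 -> lift_on (cut e2) C S phi2 ->
  (w.1 0 0 != 0) || (w.1 0 1 != 0) ->
  phi1 w - phi2 w = phi1 (pt 1 1 0) - phi2 (pt 1 1 0).
Proof.
move=> l1 l2 w0; pose d w := phi1 w - phi2 w.
have dconst (i : 'I_3) sg w1 w2 : (i == 0) || (i == 1) ->
    0 < sg * w1.1 0 i -> 0 < sg * w2.1 0 i -> d w2 = d w1.
  move=> i01 p1 p2; apply: (lift_diff_constant l1 l2) => s /andP[s0 s1].
  have pneq : (seg w1 w2 s).1 0 i != 0.
    suff : 0 < sg * (seg w1 w2 s).1 0 i by case: eqVneq => // ->; rewrite mulr0 ltxx.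
    rewrite seg_coord; have -> : sg * (w1.1 0 i + s * (w2.1 0 i - w1.1 0 i)) =
      (1 - s) * (sg * w1.1 0 i) + s * (sg * w2.1 0 i) by ring.
    case: (eqVneq s 0) => [->|sn0]; first by rewrite subr0 mul1r mul0r addr0.
    apply: ltr_wpDl; first by rewrite mulr_ge0 ?subr_ge0// ltW.
    by rewrite mulr_gt0// lt_neqAle eq_sym sn0.
  by case/orP: i01 => /eqP iE; rewrite iE in pneq; split; rewrite cutE; tauto.
have d1 : d (pt 1 (-1) 0) = d (pt 1 1 0).
  by apply: (dconst 0 1) => //; rewrite ptE; lra.
have d2 : d (pt (-1) 1 0) = d (pt 1 1 0).
  by apply: (dconst 1 1) => //; rewrite ptE; lra.
have d3 : d (pt (-1) (-1) 0) = d (pt 1 1 0).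
  by rewrite -d2; apply: (dconst 0 (-1)) => //; rewrite ptE; lra.
have neq0 (x : R) : x != 0 -> 0 < 1 * x \/ 0 < -1 * x.
  by rewrite neq_lt => /orP[]; [right|left]; lra.
rewrite -!/(d _); case/orP: w0 => /neq0[] h.
- by apply: (dconst 0 1) => //; rewrite ptE; lra.
- by rewrite -d2; apply: (dconst 0 (-1)) => //; rewrite ptE; lra.
- by apply: (dconst 1 1) => //; rewrite ptE; lra.
- by rewrite -d1; apply: (dconst 1 (-1)) => //; rewrite ptE; lra.
Qed.

(** Punctured three-space is simply connected: it is covered by two star-shaped
    sets, the complements of opposite half-axes, whose intersection is connected. *)
Lemma punctured_lift (C S : V -> R) :
  (forall w, w.1 != 0 -> {for w, continuous C}) ->
  (forall w, w.1 != 0 -> {for w, continuous S}) ->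
  (forall w, w.1 != 0 -> C w ^+ 2 + S w ^+ 2 = 1) ->
  exists phi : V -> R, lift_on [set w | w.1 != 0] C S phi.
Proof.
move=> cC cS CS1.
have cut_neq0 e w : cut e w -> w.1 != 0.
  move=> cw; apply/eqP => w0; move: cw; rewrite cutE w0 !mxE mulr0 eqxx ltxx.
  by case=> [[]|].
have lift e : e ^+ 2 = 1 -> exists phi : V -> R, lift_on (cut e) C S phi.
  move=> e1; apply: (@star_lift _ _ _ (pt 0 0 e)).
  - exact: cut_open.
  - by move=> w s cw s01; exact: cut_star.
  - by move=> w /cut_neq0; exact: cC.
  - by move=> w /cut_neq0; exact: cS.
  - by move=> w /cut_neq0; exact: CS1.
  - by right; rewrite /= ptE -expr2 e1.
have [phi1 l1] := lift 1 (expr1n _ _).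
have [phi2 l2] : exists phi : V -> R, lift_on (cut (-1)) C S phi.
  by apply: lift; rewrite sqrrN expr1n.
pose k := phi1 (pt 1 1 0) - phi2 (pt 1 1 0).
pose phi w := if `[< cut 1 w >] then phi1 w else phi2 w + k.
have c11 e : cut e (pt 1 1 0) by left; left; rewrite /= ptE oner_neq0.
(* The two lifts differ by a constant [k] off the axis, which is a multiple of a
   full turn, so that shifting the second lift by [k] leaves it a lift. *)
have [ck sk] : cos k = 1 /\ sin k = 0.
  have [_ a b] := l1 _ (c11 1); have [_ a' b'] := l2 _ (c11 (-1)).
  rewrite /k cosB sinB a b a' b' -!expr2 CS1 ?(cut_neq0 _ _ (c11 1))//.
  by rewrite [S _ * _]mulrC subrr.
have phiE w : cut (-1) w -> phi w = phi2 w + k.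
  rewrite /phi; case: asboolP => // c1 c2.
  suff w01 : (w.1 0 0 != 0) || (w.1 0 1 != 0).
    have := lift_diff_off_axis l1 l2 w01; rewrite -/k => <-; ring.
  case: c1 => [[|]|] /= h1; rewrite ?h1 ?orbT//.
  case: c2 => [[|]|] /= h2; rewrite ?h2 ?orbT//; lra.
exists phi => w; rewrite /= => w0.
have [c1|c1] := pselect (cut 1 w).
  have [cphi cc ss] := l1 _ c1.
  have phiw : phi w = phi1 w by rewrite /phi; case: asboolP.
  rewrite phiw; split=> //; rewrite /prop_for /continuous_at phiw.
  apply: cvg_trans cphi; apply: near_eq_cvg.
  have n1 : nbhs w (cut 1) by apply: open_nbhs_nbhs; split => //; exact: cut_open.
  by near=> y; rewrite /phi; case: asboolP => // -[]; near: y.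
have c2 : cut (-1) w.
  have := row3_neq0 w0; move=> /or3P[h|h|h]; [by left; left|by left; right|right=> /=].
  rewrite mulN1r oppr_gt0; case: (ltrgtP (w.1 0 2) 0) h => //= h _.
  by case: c1; right => /=; rewrite mul1r.
have [cphi cc ss] := l2 _ c2.
have phiw : phi w = phi2 w + k by exact: phiE.
rewrite phiw cosD sinD ck sk cc ss !mulr1 !mulr0 subr0 addr0; split=> //.
rewrite /prop_for /continuous_at phiw.
have c2k : (fun w => phi2 w + k) @ w --> phi2 w + k.
  by apply: cvgD; [exact: cphi|exact: cvg_cst].
apply: cvg_trans c2k; apply: near_eq_cvg.
have n2 : nbhs w (cut (-1)) by apply: open_nbhs_nbhs; split => //; exact: cut_open.
by near=> y; rewrite phiE//; near: y.
Unshelve. all: by end_near. Qed.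

End punctured_lift.

(** * The orthonormal frame and the momentum map *)

Section kepler_algebra.
Context {R : realType}.
Variable gamma : R.
Hypothesis gamma_gt0 : 0 < gamma.
Implicit Types p : 'rV[R]_4 * 'rV[R]_4.

Notation rad p := (enorm (vec p.1)).
Notation q0 p := (sca p.1).

Lemma TS3_sqr_r p : TS3 p -> rad p ^+ 2 = 1 - q0 p ^+ 2.
Proof. by move=> [qq _]; rewrite sqr_enorm -qq dot4E -expr2 addrC addKr. Qed.

(** For a unit vector [q] and [v] orthogonal to it, Lagrange's identity reads
    [|v|^2 = |mu|^2 + |pi|^2]; removing the angular part from [H] leaves the
    Kepler energy with momentum [pi]. *)
Lemma energyE p : TS3 p ->
  E gamma p = 2^-1 * dot (pi_ p) (pi_ p) - gamma * (q0 p / rad p).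
Proof.
move=> [qq qv]; have rE := TS3_sqr_r (conj qq qv).
have L : dot p.1 p.1 * dot p.2 p.2 - dot p.1 p.2 ^+ 2 =
    dot (mu p) (mu p) + dot (pi_ p) (pi_ p).
  by rewrite /mu /pi_ !dot4E !dot3E !mxE/= ?mxE; ring.
rewrite qq qv expr0n subr0 mul1r in L.
rewrite /E /H sqr_enorm L -rE sqrtr_sqr ger0_norm ?sqrtr_ge0//; ring.
Qed.

Lemma Pminus_r_gt0 p : Pminus gamma p -> 0 < rad p.
Proof.
move=> [T n1 nm1 _]; rewrite sqrtr_gt0 lt_neqAle dot_ge0 andbT eq_sym.
by rewrite -sqr_enorm TS3_sqr_r// subr_eq0 eq_sym sqrf_eq1 negb_or n1.
Qed.

(** Both the kinetic term and [gamma / r] are nonnegative, so only [q0] can make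
    the energy negative. *)
Lemma Pminus_q0_gt0 p : Pminus gamma p -> 0 < q0 p.
Proof.
move=> Pp; have r0 := Pminus_r_gt0 Pp; case: Pp => T _ _.
rewrite energyE// => E0; have P0 := dot_ge0 (pi_ p).
have : 0 < gamma * (q0 p / rad p) by lra.
by rewrite pmulr_rgt0// pmulr_lgt0// invr_gt0.
Qed.

Lemma Pminus_nu_gt0 p : Pminus gamma p -> 0 < nu gamma p.
Proof. by move=> [_ _ _ E0]; rewrite divr_gt0// sqrtr_gt0; lra. Qed.

(** The square root in [nu] enters the computations below only through this
    identity. *)
Lemma sqr_invnu p : Pminus gamma p ->
  (nu gamma p)^-1 ^+ 2 = (2 * gamma * q0 p / rad p - dot (pi_ p) (pi_ p)) / gamma ^+ 2.
Proof.
move=> Pp; case: (Pp) => T _ _ E0.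
rewrite /nu invfM invrK exprMn sqr_sqrtr; last by lra.
rewrite energyE// exprVn mulrC; congr (_ / _); field.
by rewrite gt_eqF// (Pminus_r_gt0 Pp).
Qed.

Lemma vec_alpha p : vec (alpha gamma p) = (rad p)^-1 *: vec p.1
  + (- (dot (vec p.1) (pi_ p) / (gamma * q0 p))) *: pi_ p.
Proof. by rewrite vec_quat scaleNr. Qed.

(* The zero coefficient lets the bilinear expansions treat [alpha] and [beta]
   alike. *)
Lemma vec_beta p : vec (beta gamma p) = 0 *: vec p.1
  + (rad p / (nu gamma p * q0 p)) *: pi_ p.
Proof. by rewrite vec_quat scale0r add0r. Qed.

(** Every inner product is a combination of [|q|^2], [q . pi] and [|pi|^2];
    the two squared norms contain [nu] only as [nu^-2]. *)
Lemma alpha_beta_orthonormal p : Pminus gamma p ->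
  [/\ dot (alpha gamma p) (alpha gamma p) = 1,
      dot (beta gamma p) (beta gamma p) = 1 &
      dot (alpha gamma p) (beta gamma p) = 0].
Proof.
move=> Pp; have m2 := sqr_invnu Pp.
have [[r0 q0_] nu0] := (Pminus_r_gt0 Pp, Pminus_q0_gt0 Pp, Pminus_nu_gt0 Pp).
have [rn qn gn] : [/\ rad p != 0, q0 p != 0 & gamma != 0] by rewrite !gt_eqF.
have nun : nu gamma p != 0 by rewrite gt_eqF.
rewrite !(dot4E (alpha _ _)) !(dot4E (beta _ _)) !vec_alpha !vec_beta !dot_comb.
rewrite !sca_quat -!sqr_enorm.
move: m2; rewrite -sqr_enorm; set d := dot (vec p.1) (pi_ p).
move: (nu gamma p) nun => N Nn; set P := enorm (pi_ p) ^+ 2; set Q := q0 p; set r := rad p => m2.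
split.
- transitivity (N^-1 ^+ 2 * (d / Q) ^+ 2 + 1 - 2 * d ^+ 2 / (r * gamma * Q)
      + (d / (gamma * Q)) ^+ 2 * P); first (by field; rewrite rn qn gn).
  by rewrite m2; field; rewrite rn qn gn.
- transitivity ((r / (gamma * Q) * P - 1) ^+ 2 + N^-1 ^+ 2 * (r / Q) ^+ 2 * P).
    by field; rewrite qn gn Nn.
  by rewrite m2; field; rewrite rn qn gn.
- by field; rewrite rn qn gn Nn.
Qed.

(** Both components follow from [q x pi = q0 mu]: it gives the angular momentum
    directly, and through the triple product [pi x (q x pi)] it writes the
    eccentricity vector in terms of [q] and [pi], as [alpha /\ beta] is. *)
Lemma momentum_alpha_beta p : Pminus gamma p ->
  J gamma p = (nu gamma p *: (momentum (alpha gamma p, beta gamma p)).1,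
               nu gamma p *: (momentum (alpha gamma p, beta gamma p)).2).
Proof.
move=> Pp; have m2 := sqr_invnu Pp.
have [[r0 q0_] nu0] := (Pminus_r_gt0 Pp, Pminus_q0_gt0 Pp, Pminus_nu_gt0 Pp).
have [rn qn gn] : [/\ rad p != 0, q0 p != 0 & gamma != 0] by rewrite !gt_eqF.
have nun : nu gamma p != 0 by rewrite gt_eqF.
have cross_comb a b c d (u w : 'rV[R]_3) :
    cross (a *: u + b *: w) (c *: u + d *: w) = (a * d - b * c) *: cross u w.
  by apply: row3P; rewrite !mxE/= ?mxE; ring.
have cqpi : cross (vec p.1) (pi_ p) = q0 p *: mu p.
  by rewrite /mu /pi_; apply: row3P; rewrite !mxE/= ?mxE; ring.
have muE : mu p = (q0 p)^-1 *: cross (vec p.1) (pi_ p).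
  by rewrite cqpi scalerA mulVf// scale1r.
have triple (u w : 'rV[R]_3) : cross w (cross u w) = dot w w *: u - dot u w *: w.
  by apply: row3P; rewrite !dot3E !mxE/= ?mxE; ring.
have crossZ a (u w : 'rV[R]_3) : cross w (a *: u) = a *: cross w u.
  by apply: row3P; rewrite !mxE/= ?mxE; ring.
have piE : cross (pi_ p) (mu p) = (q0 p)^-1 *: (dot (pi_ p) (pi_ p) *: vec p.1
    - dot (vec p.1) (pi_ p) *: pi_ p) by rewrite muE crossZ triple.
rewrite /J /momentum /= vec_alpha vec_beta cross_comb cqpi; congr (_, _).
  by rewrite !scalerA -[LHS]scale1r; congr (_ *: _); field; rewrite rn qn gn nun.
rewrite /etilde /e /A piE !sca_quat.
move: m2; rewrite -sqr_enorm; move: (nu gamma p) nun => N Nn.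
move: (dot (vec p.1) (pi_ p)) (enorm (pi_ p) ^+ 2) (rad p) rn (q0 p) qn => d P rr rn Q qn.
move: (vec p.1) (pi_ p) => u w m2.
apply/rowP => i; rewrite !mxE mulNr -mulrN; congr (_ * _).
move: (u 0 i) (w 0 i) => ui wi.
transitivity (N^-1 ^+ 2 * (d / Q) * (rr / Q) * wi
   - (rr / (gamma * Q) * P - 1) * (ui / rr - d / (gamma * Q) * wi)); last first.
  by field; rewrite rn qn gn Nn.
by rewrite m2; field; rewrite rn qn gn.
Qed.

End kepler_algebra.

(** * Global coordinates on the negative energy region *)

Section smooth_euclidean.
Context {R : realType} {V : normedModType R}.
Variables (A : set V) (x : V).
Hypothesis Ax : A x.

Lemma smooth_at_scale n (f : V -> R^o) (g : V -> 'rV[R]_n) :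
  smooth_at A f x -> smooth_at A g x -> smooth_at A (fun y => f y *: g y) x.
Proof.
move=> sf sg; apply: smooth_at_row => i.
apply: (@smooth_at_eq _ _ _ _ (fun y => f y * g y 0 i : R^o)).
  by move=> y _; rewrite mxE.
by apply: smooth_atM => //; exact: smooth_at_coord.
Qed.

Lemma smooth_at_dot n (f g : V -> 'rV[R]_n) :
  smooth_at A f x -> smooth_at A g x -> smooth_at A (fun y => dot (f y) (g y) : R^o) x.
Proof.
move=> sf sg; apply: (@smooth_at_sum _ _ R^o) => i.
by apply: smooth_atM; exact: smooth_at_coord.
Qed.

Lemma smooth_at_enorm n (f : V -> 'rV[R]_n) :
  f x != 0 -> smooth_at A f x -> smooth_at A (fun y => enorm (f y) : R^o) x.
Proof.
move=> fx0 sf; apply: smooth_at_sqrt => //; last exact: smooth_at_dot.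
by rewrite lt_neqAle dot_ge0 eq_sym dot_eq0 fx0.
Qed.

Lemma smooth_at_sca (f : V -> 'rV[R]_4) :
  smooth_at A f x -> smooth_at A (fun y => sca (f y) : R^o) x.
Proof.
move=> sf; apply: (@smooth_at_eq _ _ _ _ (fun y => f y 0 (lshift 3 0 : 'I_(1 + 3)) : R^o)).
  by move=> y _; rewrite /sca mxE.
exact: smooth_at_coord.
Qed.

Lemma smooth_at_vec (f : V -> 'rV[R]_4) :
  smooth_at A f x -> smooth_at A (fun y => vec (f y)) x.
Proof.
move=> sf; apply: smooth_at_row => i.
apply: (@smooth_at_eq _ _ _ _ (fun y => f y 0 (rshift 1 i : 'I_(1 + 3)) : R^o)).
  by move=> y _; rewrite /vec mxE.
exact: smooth_at_coord.
Qed.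

Lemma smooth_at_quat (f : V -> R^o) (g : V -> 'rV[R]_3) :
  smooth_at A f x -> smooth_at A g x -> smooth_at A (fun y => quat (f y) (g y)) x.
Proof.
move=> sf sg; apply: smooth_at_row => i.
case: (split_ordP (i : 'I_(1 + 3))) => j ->.
  apply: smooth_at_eq sf; move=> y _.
  apply/esym/(etrans (row_mxEl (f y)%:M (g y) 0 j)).
  by rewrite mxE ord1 eqxx mulr1n.
apply: smooth_at_eq (smooth_at_coord j sg); move=> y _.
exact/esym/(row_mxEr (f y)%:M (g y) 0 j).
Qed.

End smooth_euclidean.

Section chart.
Context {R : realType}.
Variable gamma : R.
Hypothesis gamma_gt0 : 0 < gamma.
Notation phase := ('rV[R]_4 * 'rV[R]_4)%type.
Notation coords := ('rV[R]_3 * 'rV[R]_3)%type.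
Notation Pm := (@Pminus R gamma).
Implicit Types (p : phase) (w : coords).

Lemma smooth_at_pi (p : phase) : Pm p -> smooth_at Pm (@pi_ R) p.
Proof.
move=> Pp; have s1 := smooth_at_fst (smooth_at_id Pm p).
have s2 := smooth_at_snd (smooth_at_id Pm p).
apply: (@smooth_at_eq _ _ _ _ (fun p : phase =>
    sca p.1 *: vec p.2 + (- sca p.2) *: vec p.1)).
  by move=> y _; rewrite /pi_ scaleNr.
apply: smooth_atD; apply: smooth_at_scale.
- exact: smooth_at_sca s1.
- exact: smooth_at_vec s2.
- by apply: smooth_atN; exact: smooth_at_sca s2.
- exact: smooth_at_vec s1.
Qed.

Lemma smooth_at_q0 p : Pm p -> smooth_at Pm (fun p => sca p.1 : R^o) p.
Proof. by move=> Pp; apply: smooth_at_sca; exact: smooth_at_fst (smooth_at_id Pm p). Qed.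

Lemma smooth_at_qvec p : Pm p -> smooth_at Pm (fun p => vec p.1) p.
Proof. by move=> Pp; apply: smooth_at_vec; exact: smooth_at_fst (smooth_at_id Pm p). Qed.

Lemma smooth_at_r p : Pm p -> smooth_at Pm (fun p => enorm (vec p.1) : R^o) p.
Proof.
move=> Pp; apply: smooth_at_enorm => //; last exact: smooth_at_qvec.
by have := Pminus_r_gt0 Pp; rewrite sqrtr_gt0 lt_neqAle eq_sym dot_eq0 => /andP[].
Qed.

Lemma smooth_at_nu p : Pm p -> smooth_at Pm (fun p => nu gamma p : R^o) p.
Proof.
move=> Pp; have r0 := Pminus_r_gt0 Pp.
apply: (@smooth_at_eq _ _ _ _ (fun p : phase => gamma / Num.sqrt
    (dot (pi_ p) (pi_ p) * -1 + 2 * gamma * (sca p.1 / enorm (vec p.1))) : R^o)).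
  move=> y [Ty _ _ _]; rewrite /nu energyE//; congr (_ / Num.sqrt _).
  lra.
have [T _ _ E0] := Pp; rewrite energyE// in E0.
have e0 : 0 < dot (pi_ p) (pi_ p) * -1 + 2 * gamma * (sca p.1 / enorm (vec p.1)) by lra.
apply: smooth_atM; first exact: smooth_at_cst.
apply: smooth_atV => //; first by rewrite gt_eqF// sqrtr_gt0.
apply: smooth_at_sqrt => //; apply: smooth_atD.
  apply: smooth_atM; last exact: smooth_at_cst.
  by apply: smooth_at_dot; exact: smooth_at_pi.
apply: smooth_atM; first exact: smooth_at_cst.
apply: smooth_atM; first exact: smooth_at_q0.
by apply: smooth_atV => //; [rewrite gt_eqF|exact: smooth_at_r].
Qed.

Lemma smooth_at_alpha p : Pm p -> smooth_at Pm (@alpha R gamma) p.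
Proof.
move=> Pp; have [r0 q0 nu0] := And3 (Pminus_r_gt0 Pp) (Pminus_q0_gt0 gamma_gt0 Pp)
  (Pminus_nu_gt0 gamma_gt0 Pp).
have sd : smooth_at Pm (fun p => dot (vec p.1) (pi_ p) : R^o) p.
  by apply: smooth_at_dot; [exact: smooth_at_qvec|exact: smooth_at_pi].
apply: smooth_at_quat.
  apply: smooth_atM => //; apply: smooth_atV => //; first by rewrite mulf_neq0// gt_eqF.
  by apply: smooth_atM; [exact: smooth_at_nu|exact: smooth_at_q0].
apply: (@smooth_at_eq _ _ _ _ (fun p : phase => (enorm (vec p.1))^-1 *: vec p.1
   + (- (dot (vec p.1) (pi_ p) / (gamma * sca p.1))) *: pi_ p)).
  by move=> y _; rewrite scaleNr.
apply: smooth_atD; apply: smooth_at_scale.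
- by apply: smooth_atV => //; [rewrite gt_eqF|exact: smooth_at_r].
- exact: smooth_at_qvec.
- apply: smooth_atN; apply: smooth_atM => //; apply: smooth_atV => //.
    by rewrite mulf_neq0// gt_eqF.
  by apply: smooth_atM; [exact: smooth_at_cst|exact: smooth_at_q0].
- exact: smooth_at_pi.
Qed.

Lemma smooth_at_beta p : Pm p -> smooth_at Pm (@beta R gamma) p.
Proof.
move=> Pp; have [r0 q0 nu0] := And3 (Pminus_r_gt0 Pp) (Pminus_q0_gt0 gamma_gt0 Pp)
  (Pminus_nu_gt0 gamma_gt0 Pp).
apply: smooth_at_quat.
  apply: smooth_atB; last exact: smooth_at_cst.
  apply: smooth_atM; last by apply: smooth_at_dot; exact: smooth_at_pi.
  apply: smooth_atM; first exact: smooth_at_r.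
  apply: smooth_atV => //; first by rewrite mulf_neq0// gt_eqF.
  by apply: smooth_atM; [exact: smooth_at_cst|exact: smooth_at_q0].
apply: smooth_at_scale; last exact: smooth_at_pi.
apply: smooth_atM; first exact: smooth_at_r.
apply: smooth_atV => //; first by rewrite mulf_neq0// gt_eqF.
by apply: smooth_atM; [exact: smooth_at_nu|exact: smooth_at_q0].
Qed.

(** The gnomonic projection of [q] from the open upper half-sphere, together with
    [pi] rescaled so that the bound imposed on it by negative energy becomes
    void: these coordinates identify [Pminus] with the product of punctured
    three-space and three-space. *)
Definition chart p : coords :=
  ((sca p.1)^-1 *: vec p.1, (nu gamma p / gamma) *: pi_ p).

Definition chart_q0 w : R := (Num.sqrt (1 + dot w.1 w.1))^-1.

Definition chart_pi w : 'rV[R]_3 :=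
  Num.sqrt (2 * gamma / (enorm w.1 * (1 + dot w.2 w.2))) *: w.2.

(* The orthogonality of [v] to [q] forces [v0 = - q . pi]. *)
Definition chart_v0 w : R := - (chart_q0 w * dot w.1 (chart_pi w)).

Definition unchart w : phase :=
  (quat (chart_q0 w) (chart_q0 w *: w.1),
   quat (chart_v0 w) ((chart_q0 w)^-1 *: chart_pi w + chart_v0 w *: w.1)).

Lemma chart_q0_gt0 w : 0 < chart_q0 w.
Proof. by rewrite invr_gt0 sqrtr_gt0 ltr_pwDl// dot_ge0. Qed.

Lemma sqr_chart_q0 w : chart_q0 w ^+ 2 * (1 + dot w.1 w.1) = 1.
Proof.
have n0 : 0 < 1 + dot w.1 w.1 by rewrite ltr_pwDl// dot_ge0.
by rewrite exprVn sqr_sqrtr ?mulVf ?gt_eqF// ltW.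
Qed.

Lemma unchart_Pminus w : w.1 != 0 -> Pm (unchart w).
Proof.
move=> w0; have q0 := chart_q0_gt0 w; have q2 := sqr_chart_q0 w.
have aa : 0 < dot w.1 w.1 by rewrite lt_neqAle dot_ge0 eq_sym dot_eq0 w0.
have T : TS3 (unchart w).
  split; rewrite /= dot4E !sca_quat !vec_quat.
    by rewrite dotZl dotZr -q2; ring.
  rewrite /chart_v0; move: (chart_pi w) => b; rewrite dotZl dotDr !dotZr.
  transitivity (dot w.1 b * (1 - chart_q0 w ^+ 2 * (1 + dot w.1 w.1))).
    by field; rewrite gt_eqF.
  by rewrite q2 subrr mulr0.
have piE : pi_ (unchart w) = chart_pi w.
  rewrite /pi_ /= !sca_quat !vec_quat; move: (chart_pi w) (chart_v0 w) => b v0.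
  by apply/rowP => i; rewrite !mxE; field; rewrite gt_eqF.
have n0 : 0 < enorm w.1 by rewrite sqrtr_gt0.
have rE : enorm (vec (unchart w).1) = chart_q0 w * enorm w.1.
  rewrite /= vec_quat /enorm dotZl dotZr mulrA -expr2 sqrtrM ?sqr_ge0//.
  by rewrite sqrtr_sqr gtr0_norm.
split=> //.
- rewrite /= sca_quat; apply/eqP => q1; move: q2; rewrite q1 expr1n mul1r; lra.
- by rewrite /= sca_quat gt_eqF// (lt_trans _ q0)// oppr_lt0.
- rewrite energyE// piE rE sca_quat /chart_pi dotZl dotZr mulrA -expr2.
  have c0 := dot_ge0 w.2; set c := dot w.2 w.2 in c0 *.
  have c1 : 0 < 1 + c by rewrite ltr_pwDl.
  rewrite sqr_sqrtr; last by rewrite divr_ge0 ?mulr_ge0// ltW.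
  have -> : 2^-1 * (2 * gamma / (enorm w.1 * (1 + c)) * c) -
     gamma * (chart_q0 w / (chart_q0 w * enorm w.1)) =
     - (gamma / (enorm w.1 * (1 + c))) by field; rewrite !gt_eqF.
  by rewrite oppr_lt0 divr_gt0// mulr_gt0.
Qed.

Lemma chart_neq0 p : Pm p -> (chart p).1 != 0.
Proof.
move=> Pp; rewrite /= scaler_eq0 invr_eq0 gt_eqF ?(Pminus_q0_gt0 gamma_gt0 Pp)//=.
by have := Pminus_r_gt0 Pp; rewrite sqrtr_gt0 lt_neqAle eq_sym dot_eq0 => /andP[].
Qed.

Lemma chartK p : Pm p -> unchart (chart p) = p.
Proof.
move=> Pp; have m2 := sqr_invnu Pp; case: (Pp) => T _ _ _.
have [r0 q0 nu0] := And3 (Pminus_r_gt0 Pp) (Pminus_q0_gt0 gamma_gt0 Pp)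
  (Pminus_nu_gt0 gamma_gt0 Pp).
have rr := TS3_sqr_r T.
have q0E : chart_q0 (chart p) = sca p.1.
  rewrite /chart_q0 /= dotZl dotZr -sqr_enorm rr.
  have -> : 1 + (sca p.1)^-1 * ((sca p.1)^-1 * (1 - sca p.1 ^+ 2)) = (sca p.1)^-1 ^+ 2.
    by field; rewrite gt_eqF.
  by rewrite sqrtr_sqr gtr0_norm ?invrK// invr_gt0.
have nE : enorm (chart p).1 = enorm (vec p.1) / sca p.1.
  rewrite /enorm /= dotZl dotZr mulrA -expr2 sqrtrM ?sqr_ge0// sqrtr_sqr.
  by rewrite gtr0_norm ?invr_gt0// mulrC.
have piE : chart_pi (chart p) = pi_ p.
  rewrite /chart_pi nE /= !dotZl !dotZr scalerA.
  move: m2; move: (nu gamma p) nu0 (dot (pi_ p) (pi_ p)) (sca p.1) q0 (enorm (vec p.1)) r0.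
  move=> N N0 P Q Q0 r r0 m2.
  have [Nn gn Qn rn] :=
    And4 (lt0r_neq0 N0) (lt0r_neq0 gamma_gt0) (lt0r_neq0 Q0) (lt0r_neq0 r0).
  have PE : P = 2 * gamma * Q / r - (gamma / N) ^+ 2.
    by rewrite expr_div_n -[in X in _ - X]exprVn m2; field; rewrite gn rn.
  have -> : 1 + N / gamma * (N / gamma * P) = 2 * Q * N ^+ 2 / (r * gamma).
    by rewrite PE; field; rewrite ?Nn ?gn ?Qn ?rn.
  have -> : 2 * gamma / (r / Q * (2 * Q * N ^+ 2 / (r * gamma))) = (gamma / N) ^+ 2.
    by field; rewrite ?Nn ?gn ?Qn ?rn.
  rewrite sqrtr_sqr gtr0_norm ?divr_gt0//.
  have -> : gamma / N * (N / gamma) = 1 by field; rewrite Nn gn.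
  by rewrite scale1r.
have v0E : chart_v0 (chart p) = sca p.2.
  rewrite /chart_v0 q0E piE /= dotZl mulrA mulfV ?gt_eqF// mul1r.
  have [_ qv] := T; rewrite dot4E in qv.
  rewrite /pi_ -scaleNr dotDr !dotZr -sqr_enorm rr.
  have -> : dot (vec p.1) (vec p.2) = - (sca p.1 * sca p.2) by lra.
  ring.
rewrite /unchart q0E piE v0E [RHS]surjective_pairing; congr (_, _); apply: quat_eq.
- by rewrite sca_quat.
- by rewrite vec_quat /= scalerA mulfV ?gt_eqF// scale1r.
- by rewrite sca_quat.
- rewrite vec_quat /= /pi_; apply/rowP => i.
  by move: (vec p.1) (vec p.2) => u v; rewrite !mxE; field; rewrite gt_eqF.
Qed.

Lemma smooth_at_chart p : Pm p -> smooth_at Pm chart p.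
Proof.
move=> Pp; apply: smooth_at_pair; apply: smooth_at_scale.
- by apply: smooth_atV => //; [rewrite gt_eqF// (Pminus_q0_gt0 gamma_gt0 Pp)|exact: smooth_at_q0].
- exact: smooth_at_qvec.
- by apply: smooth_atM; [exact: smooth_at_nu|exact: smooth_at_cst].
- exact: smooth_at_pi.
Qed.

Lemma unchart_continuous w : w.1 != 0 -> {for w, continuous unchart}.
Proof.
move=> w0; pose A : set coords := setT.
have Aw : A w by [].
have n0 (v : 'rV[R]_3) : 0 < 1 + dot v v by rewrite ltr_pwDl// dot_ge0.
have s1 := smooth_at_fst (smooth_at_id A w).
have s2 := smooth_at_snd (smooth_at_id A w).
have saa : smooth_at A (fun w => 1 + dot w.1 w.1 : R^o) w.
  by apply: smooth_atD; [exact: smooth_at_cst|exact: smooth_at_dot].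
have scc : smooth_at A (fun w => 1 + dot w.2 w.2 : R^o) w.
  by apply: smooth_atD; [exact: smooth_at_cst|exact: smooth_at_dot].
have sq : smooth_at A (fun w => chart_q0 w : R^o) w.
  apply: smooth_atV => //; first by rewrite gt_eqF// sqrtr_gt0.
  exact: smooth_at_sqrt.
have aa : 0 < enorm w.1 by rewrite sqrtr_gt0 lt_neqAle dot_ge0 eq_sym dot_eq0 w0.
have spi : smooth_at A chart_pi w.
  apply: smooth_at_scale => //; apply: smooth_at_sqrt => //.
    by rewrite divr_gt0 ?mulr_gt0.
  apply: smooth_atM; first exact: smooth_at_cst.
  apply: smooth_atV => //; first by rewrite gt_eqF// mulr_gt0.
  by apply: smooth_atM => //; exact: smooth_at_enorm.
have sv : smooth_at A (fun w => chart_v0 w : R^o) w.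
  by apply: smooth_atN; apply: smooth_atM => //; exact: smooth_at_dot.
have su : smooth_at A unchart w.
  apply: smooth_at_pair; apply: smooth_at_quat => //; first exact: smooth_at_scale.
  apply: smooth_atD; apply: smooth_at_scale => //.
  by apply: smooth_atV => //; rewrite gt_eqF// chart_q0_gt0.
exact: smooth_at_setT_continuous su.
Qed.

End chart.

(** * Smooth angles on the negative energy region *)

Section smooth_lift.
Context {R : realType} {V : normedModType R}.

Lemma angle_step_tan (t0 t : R) : `|t - t0| < pi / 2 ->
  t = t0 + angle_step (cos t0) (sin t0) (cos t) (sin t).
Proof.
move=> tt; rewrite /angle_step -sinB -cosB -/(tan (t - t0)) tanK; first by ring.
by rewrite in_itv/= -ltr_norml.
Qed.

(** A continuous angle is as smooth as its sine and cosine: near a given point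
    it is that point's angle plus the arctangent of a smooth function. *)
Lemma smooth_lift (A : set V) (C S phi : V -> R^o) x : A x ->
  smooth_at A C x -> smooth_at A S x ->
  (forall y, A y -> cos (phi y) = C y /\ sin (phi y) = S y) ->
  phi @ within A (nbhs x) --> phi x -> smooth_at A phi x.
Proof.
move=> Ax sC sS cs cphi; have [Cx Sx] := cs x Ax.
apply: (@smooth_at_ext _ _ R^o _ (fun y =>
    phi x + atan ((S y * C x - C y * S x) / (C y * C x + S y * S x)))).
  have pi2 : 0 < pi / 2 :> R by rewrite divr_gt0// pi_gt0.
  have nphi : \forall y \near x, A y -> `|phi x - phi y| < pi / 2.
    by have /cvgrPdist_lt/(_ _ pi2) := cphi.
  near=> y => Ay; have [Cy Sy] := cs y Ay.
  rewrite -Cx -Sx -Cy -Sy; apply/esym/angle_step_tan.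
  by rewrite distrC; apply: (near nphi y).
have u : C x * C x + S x * S x = 1 by rewrite -Cx -Sx -!expr2 cos2Dsin2.
apply: smooth_atD; first exact: smooth_at_cst.
apply: smooth_at_atan => //; apply: smooth_atM.
  by apply: smooth_atB; apply: smooth_atM => //; exact: smooth_at_cst.
apply: smooth_atV => //; first by rewrite u oner_neq0.
by apply: smooth_atD; apply: smooth_atM => //; exact: smooth_at_cst.
Unshelve. all: by end_near. Qed.

End smooth_lift.

Section global_angle.
Context {R : realType}.
Variable gamma : R.
Hypothesis gamma_gt0 : 0 < gamma.
Notation phase := ('rV[R]_4 * 'rV[R]_4)%type.
Notation coords := ('rV[R]_3 * 'rV[R]_3)%type.
Notation Pm := (@Pminus R gamma).

(** The coordinates of [chart] turn a circle-valued map on [Pminus] into one on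
    the product of punctured three-space and three-space, where it lifts. *)
Lemma Pminus_lift (C S : phase -> R^o) :
  smooth_on Pm C -> smooth_on Pm S ->
  (forall p, Pm p -> C p ^+ 2 + S p ^+ 2 = 1) ->
  exists phi : phase -> R^o, smooth_on Pm phi /\
    forall p, Pm p -> cos (phi p) = C p /\ sin (phi p) = S p.
Proof.
move=> sC sS CS1.
have pull (f : phase -> R^o) : smooth_on Pm f -> forall w : coords, w.1 != 0 ->
    {for w, continuous (fun w => f (unchart gamma w) : R)}.
  move=> sf w w0; have Pw := unchart_Pminus gamma_gt0 w0.
  have cf := smooth_at_continuous Pw (sf _ Pw).
  move=> B nB.
  have n1 : \forall p \near unchart gamma w, Pm p -> B (f p) by exact: cf B nB.
  have n2 : \forall w' \near w, Pm (unchart gamma w') -> B (f (unchart gamma w')).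
    exact: (unchart_continuous gamma_gt0 w0 n1).
  have c1 : {for w, continuous (fun w : coords => dot w.1 w.1 : R^o)}.
    apply: smooth_at_setT_continuous; apply: smooth_at_dot; apply: smooth_at_fst;
      exact: smooth_at_id.
  have n3 : \forall w' \near w, dot w'.1 w'.1 != 0.
    have nd : nbhs (dot w.1 w.1 : R^o) [set x : R^o | x != 0].
      by apply: open_nbhs_nbhs; split; [exact: openR_neq0|rewrite /= dot_eq0].
    exact: c1 nd.
  have n4 : \forall w' \near w, B (f (unchart gamma w')).
    near=> w'; have := near n2 w'; apply=> //; apply: unchart_Pminus => //.
    by rewrite -dot_eq0; near: w'; exact: n3.
  exact: n4.
have [phi phiP] := @punctured_lift R 'rV[R]_3 _ _ (pull C sC) (pull S sS)
  (fun w w0 => CS1 _ (unchart_Pminus gamma_gt0 w0)).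
have csphi p : Pm p -> cos (phi (chart gamma p)) = C p /\ sin (phi (chart gamma p)) = S p.
  move=> Pp; have [_ cc ss] := phiP _ (chart_neq0 gamma_gt0 Pp).
  by rewrite cc ss chartK.
exists (fun p => phi (chart gamma p)); split=> // p Pp.
apply: (smooth_lift Pp (sC p Pp) (sS p Pp)) => //.
have [cphi _ _] := phiP _ (chart_neq0 gamma_gt0 Pp).
exact: cvg_comp (smooth_at_continuous Pp (smooth_at_chart gamma_gt0 Pp)) cphi.
Unshelve. all: by end_near. Qed.

End global_angle.

(** * Maps intertwining the momentum maps *)

Theorem theorem5p3 (R : realType) (gamma : R) (gamma_gt0 : 0 < gamma)
    (Phi : 'rV[R]_4 * 'rV[R]_4 -> 'rV[R]_4 * 'rV[R]_4) :
  (smooth_map (Pminus gamma) TplusS3 Phi /\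
   (forall p, Pminus gamma p -> momentum (Phi p) = J gamma p))
  <->
  (exists phi : 'rV[R]_4 * 'rV[R]_4 -> R^o,
     smooth_on (Pminus gamma) phi /\
     forall p, Pminus gamma p ->
       Phi p = (sin (phi p) *: alpha gamma p + cos (phi p) *: beta gamma p,
                nu gamma p *: (- cos (phi p) *: alpha gamma p
                               + sin (phi p) *: beta gamma p))).
Proof.
split.
- move=> [[sPhi PhiT] PhiJ].
  (* At each point [Phi p] is the frame rotated by an angle whose cosine and sine
     are the inner products with [beta] and [alpha]; only the angle itself is
     missing, as a smooth function. *)
  have rot p (Pp : Pminus gamma p) :=
    let: And3 aa bb ab := alpha_beta_orthonormal gamma_gt0 Pp in
    let: And3 xx xy y0 := PhiT p Pp in
    wedge_rotation aa bb ab (Pminus_nu_gt0 gamma_gt0 Pp) xx xy y0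
      (etrans (congr1 momentum (esym (surjective_pairing (Phi p))))
        (etrans (PhiJ p Pp) (momentum_alpha_beta gamma_gt0 Pp))).
  have sx p : Pminus gamma p -> smooth_at (Pminus gamma) (fun p => (Phi p).1) p.
    by move=> Pp; exact: smooth_at_fst (sPhi p Pp).
  have [||p Pp|phi [sphi csphi]] := @Pminus_lift _ _ gamma_gt0
      (fun p => dot (beta gamma p) (Phi p).1) (fun p => dot (alpha gamma p) (Phi p).1).
  + by move=> p Pp; apply: smooth_at_dot; [exact: smooth_at_beta|exact: sx].
  + by move=> p Pp; apply: smooth_at_dot; [exact: smooth_at_alpha|exact: sx].
  + by have [] := rot p Pp.
  exists phi; split=> // p Pp; have [c s] := csphi p Pp; have [xE yE _] := rot p Pp.
  by rewrite c s [LHS]surjective_pairing {1}xE {1}yE.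
- move=> [phi [sphi PhiE]].
  have cs1 p : cos (phi p) ^+ 2 + sin (phi p) ^+ 2 = 1 by exact: cos2Dsin2.
  split; first split.
  + move=> p Pp; apply: smooth_at_eq (fun p Pp => esym (PhiE p Pp)) _.
    have ss : smooth_at (Pminus gamma) (fun p => sin (phi p) : R^o) p.
      by apply: smooth_at_sin => //; exact: sphi.
    have sc : smooth_at (Pminus gamma) (fun p => cos (phi p) : R^o) p.
      by apply: smooth_at_cos => //; exact: sphi.
    have sa := smooth_at_alpha gamma_gt0 Pp; have sb := smooth_at_beta gamma_gt0 Pp.
    apply: smooth_at_pair; first by apply: smooth_atD; exact: smooth_at_scale.
    apply: smooth_at_scale; first exact: smooth_at_nu.
    apply: smooth_atD; apply: smooth_at_scale => //; exact: smooth_atN.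
  + move=> p Pp; rewrite PhiE//; have [aa bb ab] := alpha_beta_orthonormal gamma_gt0 Pp.
    have nu0 := Pminus_nu_gt0 gamma_gt0 Pp.
    split=> /=.
    * by rewrite dot_comb aa bb ab mulr0 !mulr1 addr0 -!expr2 addrC.
    * by rewrite dotZr dot_comb aa bb ab mulr0 !mulr1 addr0; ring.
    * rewrite -dot_eq0 dotZl dotZr dot_comb aa bb ab mulr0 !mulr1 addr0 mulrNN -!expr2.
      by rewrite cs1 mulr1 mulf_neq0// gt_eqF.
  + move=> p Pp; rewrite PhiE// (momentum_alpha_beta gamma_gt0 Pp).
    rewrite scalerDr !scalerA momentum_comb.
    suff -> : sin (phi p) * (nu gamma p * sin (phi p)) -
      cos (phi p) * (nu gamma p * - cos (phi p)) = nu gamma p by [].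
    by rewrite -[RHS]mulr1 -(cs1 p); ring.
Qed.
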